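(* Let $\mathfrak{o}$ be the ring of integers in a local field $F$ of characteristic zero with residue field of characteristic $p>0$, let $G$ be a finite group, let $\Lambda := \mathfrak{o}[G]$, and let $\Lambda'$ be a maximal $\mathfrak{o}$-order in $F[G]$ containing $\Lambda$. With $\chi_i$, $\mathfrak{o}_i'$, $\mathfrak{A}_i$ ($1\le i\le k$) as defined in the context, we have an equality $$\mathcal{F}(\zeta(\Lambda'),\zeta(\Lambda)) = \bigoplus_{i=1}^k\frac{|G|}{\chi_i(1)}\mathfrak{A}_i^{-1}\mathfrak{D}^{-1}(\mathfrak{o}_i'/\mathfrak{o}).$$
   Context: $\zeta(\cdot)$ denotes the centre of a ring, and $\mathcal{F}(\zeta(\Lambda'),\zeta(\Lambda)) := \{x\in\zeta(\Lambda')\mid x\,\zeta(\Lambda')\subset\zeta(\Lambda)\}$. Let $\overline{F}$ be an algebraic closure of $F$ and let $\chi_1,\dots,\chi_k$ be representatives of the irreducible $\overline{F}$-valued characters of $G$ modulo the action of $\mathrm{Gal}(\overline{F}/F)$. Let $F_i := F(\chi_i(g)\mid g\in G)$ and let $\mathfrak{o}_i'$ be its ring of integers. There are natural identifications $\zeta(F[G])\simeq\bigoplus_{i=1}^kF_i$ and $\zeta(\Lambda')\simeq\bigoplus_{i=1}^k\mathfrak{o}_i'$, where $\alpha_i\in F_i$ corresponds to $\sum_{\sigma\in\mathrm{Gal}(F_i/F)}\alpha_i^\sigma\frac{\chi_i(1)}{|G|}\sum_{g\in G}\chi_i^\sigma(g^{-1})g$. Let $\mathfrak{A}_i := \langle\chi_i(g)\mid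 g\in G\rangle_{\mathfrak{o}_i'}$ be the ideal of $\mathfrak{o}_i'$ generated by the values of $\chi_i$, $\mathfrak{A}_i^{-1}$ its inverse fractional ideal, and $\mathfrak{D}^{-1}(\mathfrak{o}_i'/\mathfrak{o}) := \{x\in F_i\mid\mathrm{Tr}_{F_i/F}(x\mathfrak{o}_i')\subset\mathfrak{o}\}$ the inverse different. *)

(* Defs.v *)
From HB Require Import structures.
From mathcomp Require Import all_boot all_order all_algebra all_fingroup.
From mathcomp Require Import mxrepresentation.
From mathcomp Require Import boolp classical_sets functions cardinality fsbigop.

Set Implicit Arguments.
Unset Strict Implicit.
Unset Printing Implicit Defensive.

Import Order.TTheory GRing.Theory Num.Theory.

Local Open Scope classical_set_scope.
Local Open Scope ring_scope.

(* The value of a valuation v at 0 is junk: 0 is always treated separately. *)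
Section LocalField.
Variables (F : fieldType) (v : F -> int).

Definition val_ring : {pred F} := [pred x | (x == 0) || (0 <= v x)].
Definition val_max : {pred F} := [pred x | (x == 0) || (0 < v x)].

Definition val_near (N : int) (x y : F) : Prop := x = y \/ N <= v (x - y).

Definition val_complete : Prop :=
  forall u : nat -> F,
    (forall N : int, exists n0 : nat,
       forall m n : nat, (n0 <= m)%N -> (n0 <= n)%N -> val_near N (u m) (u n)) ->
    exists l : F, forall N : int, exists n0 : nat,
      forall n : nat, (n0 <= n)%N -> val_near N (u n) l.

(* Nonarchimedean local field: complete for a normalised discrete valuation,
   with finite residue field val_ring / val_max. *)
Record local_field : Prop := LocalField {
  val_mul : forall x y, x != 0 -> y != 0 -> v (x * y) = v x + v y;
  val_add : forall x y, x != 0 -> y != 0 -> x + y != 0 ->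
    Num.min (v x) (v y) <= v (x + y);
  val_unif : exists2 pi, pi != 0 & v pi = 1;
  val_compl : val_complete;
  val_residue_fin : exists s : seq F,
    forall x, x \in val_ring -> exists2 y, y \in s & x - y \in val_max
}.

Definition residue_pchar (p : nat) : Prop := prime p /\ p%:R \in val_max.

End LocalField.

(* Finite sums of c *: x with c in S and x in X.  With V := K^o this is also the
   product of two (fractional) ideals, or the S-ideal generated by X. *)
Definition span_over (K : pzRingType) (V : lmodType K) (S : set K) (X : set V) :
    set V :=
  [set x | exists n (c : 'I_n -> K) (y : 'I_n -> V),
     [/\ forall i, S (c i), forall i, X (y i) & x = \sum_(i < n) c i *: y i]].

Section Orders.
Variables (F : fieldType) (o : {pred F}).

Definition centre (R : pzRingType) (A : set R) : set R :=
  [set x | A x /\ forall y, A y -> x * y = y * x].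

Definition conductor (R : pzRingType) (A B : set R) : set R :=
  [set x | A x /\ forall y, A y -> B (x * y)].

(* L is an o-order in the F-subalgebra A of 'M[F]_n: a subring of A, finitely
   generated over o, whose F-span is A. *)
Record is_order (n : nat) (A L : set 'M[F]_n) : Prop := IsOrder {
  order_sub : L `<=` A;
  order_1 : L 1%:M;
  order_B : forall x y, L x -> L y -> L (x - y);
  order_M : forall x y, L x -> L y -> L (x *m y);
  order_fg : exists s : seq 'M[F]_n, L = span_over [set` o] [set` s];
  order_full : A = span_over [set: F] L
}.

Definition is_maximal_order (n : nat) (A L : set 'M[F]_n) : Prop :=
  is_order A L /\ forall M : set 'M[F]_n, is_order A M -> L `<=` M -> M = L.

End Orders.

(* F[G] and o[G] inside 'M[F]_#|G|, through the regular representation. *)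
Section GroupRing.
Variables (F : fieldType) (gT : finGroupType) (G : {group gT}).

Definition grp_alg : set 'M[F]_#|G| := [set x | (x \in group_ring F G)%MS].

Definition grp_ring_over (o : {pred F}) : set 'M[F]_#|G| :=
  [set x | exists2 a : gT -> F, forall g, g \in G -> a g \in o &
     x = \sum_(g in G) a g *: regular_repr F G g].

End GroupRing.

Arguments grp_alg F {gT} G.
Arguments grp_ring_over {F gT} G o.

Section AdjoinDef.
Variables (F E : fieldType) (iota : {rmorphism F -> E}) (S : set E).

(* The smallest subfield of E containing iota(F) and S. *)
Definition adjoin_pred : {pred E} := fun x =>
  `[< forall D : {pred E}, divring_closed D ->
        (forall a, iota a \in D) -> (forall s, S s -> s \in D) -> x \in D >].

Lemma adjoin_closed : divring_closed adjoin_pred.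
Proof.
split=> [|x y|x y].
- by apply/asboolP => D [].
- move=> /asboolP hx /asboolP hy; apply/asboolP => D DD Da Ds.
  by case: (DD) => _ B _; apply: B; [apply: hx | apply: hy].
- move=> /asboolP hx /asboolP hy; apply/asboolP => D DD Da Ds.
  by case: (DD) => _ _ M; apply: M; [apply: hx | apply: hy].
Qed.

Lemma adjoin_base a : iota a \in adjoin_pred.
Proof. by apply/asboolP => D _ Da _; apply: Da. Qed.

Lemma adjoin_gen s : S s -> s \in adjoin_pred.
Proof. by move=> Ss; apply/asboolP => D _ _ Ds; apply: Ds. Qed.

End AdjoinDef.

HB.instance Definition _ (F E : fieldType) (iota : {rmorphism F -> E})
    (S : set E) :=
  GRing.isDivringClosed.Build E (adjoin_pred iota S) (adjoin_closed iota S).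

Record adjoin (F E : fieldType) (iota : {rmorphism F -> E}) (S : set E) :=
  Adjoin { adjoin_val :> E; _ : adjoin_val \in adjoin_pred iota S }.

HB.instance Definition _ (F E : fieldType) (iota : {rmorphism F -> E})
    (S : set E) := [isSub for @adjoin_val F E iota S].
HB.instance Definition _ (F E : fieldType) (iota : {rmorphism F -> E})
    (S : set E) := [Choice of adjoin iota S by <:].
HB.instance Definition _ (F E : fieldType) (iota : {rmorphism F -> E})
    (S : set E) := [SubChoice_isSubIntegralDomain of adjoin iota S by <:].
HB.instance Definition _ (F E : fieldType) (iota : {rmorphism F -> E})
    (S : set E) := [SubIntegralDomain_isSubField of adjoin iota S by <:].

Definition in_adjoin (F E : fieldType) (iota : {rmorphism F -> E}) (S : set E) :
    F -> adjoin iota S :=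
  fun a => Adjoin (adjoin_base iota S a).

Section Extensions.
Variables (F E : fieldType) (f : F -> E).

Definition Gal : set (E -> E) :=
  [set s | [/\ zmod_morphism s, monoid_morphism s, bijective s &
               forall a, s (f a) = f a]].

(* Trace of a finite Galois extension, as in mathcomp's galTrace.  It is only
   used for E = F(chi), which lies in a cyclotomic extension of F, so that E / F
   is finite abelian.  (The sum over an infinite Gal would be a junk value.) *)
Definition Tr (x : E) : E := \sum_(s \in Gal) s x.

(* The ring of integers of E: the integral closure of o in E. *)
Definition int_closure (o : {pred F}) : set E :=
  [set x | exists p : {poly F},
     [/\ p \is monic, p \is a polyOver o & root (map_poly f p) x]].

Definition inv_different (o : {pred F}) : set E :=
  [set x | forall y, int_closure o y -> exists2 a, a \in o & Tr (x * y) = f a].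

End Extensions.

Definition ideal_inv (E : fieldType) (O I : set E) : set E :=
  [set x | forall y, I y -> O (x * y)].

Definition ideal_mul (E : fieldType) (I J : set E) : set E :=
  span_over I (J : set E^o).

Section Characters.
Variables (F : fieldType) (Fbar : closedFieldType) (iota : {rmorphism F -> Fbar}).
Variables (gT : finGroupType) (G : {group gT}).

Definition is_alg_closure : Prop := forall x : Fbar, algebraicOver iota x.

(* Only the values on G of a function chi : gT -> Fbar are relevant. *)
Definition irr_char (chi : gT -> Fbar) : Prop :=
  exists n (rG : mx_representation Fbar G n),
    mx_irreducible rG /\ {in G, forall g, chi g = \tr (rG g)}.

Definition gal_conj (chi psi : gT -> Fbar) : Prop :=
  exists2 s, Gal iota s & {in G, forall g, psi g = s (chi g)}.

Definition irr_representatives (k : nat) (chi : 'I_k -> gT -> Fbar) : Prop :=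
  [/\ forall i, irr_char (chi i),
      forall psi, irr_char psi -> exists i, gal_conj (chi i) psi &
      forall i j, gal_conj (chi i) (chi j) -> i = j].

(* F(chi(g) | g in G) *)
Definition char_field (chi : gT -> Fbar) : fieldType :=
  adjoin iota [set chi g | g in [set` G]].

Definition to_char_field (chi : gT -> Fbar) : F -> char_field chi :=
  @in_adjoin F Fbar iota [set chi g | g in [set` G]].

(* chi(g) as an element of F(chi), for g in G; the default 0 is never used. *)
Definition char_val (chi : gT -> Fbar) (g : gT) : char_field chi :=
  insubd (0 : adjoin iota [set chi g | g in [set` G]]) (chi g).

Lemma char_valE (chi : gT -> Fbar) g : g \in G ->
  adjoin_val (char_val chi g) = chi g.
Proof. by move=> Gg; apply: insubdK; apply: adjoin_gen; exists g. Qed.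

Section CharIdeals.
Variables (o : {pred F}) (chi : gT -> Fbar).

Let E := char_field chi.

Definition char_int : set E := int_closure (to_char_field chi) o.

Definition char_ideal : set E :=
  ideal_mul char_int [set char_val chi g | g in [set` G]].

(* (|G| / chi(1)) A^-1 D^-1 *)
Definition conductor_summand : set E :=
  [set (#|G|%:R / char_val chi 1%g) * x | x in
     ideal_mul (ideal_inv char_int char_ideal)
               (inv_different (to_char_field chi) o)].

End CharIdeals.

(* The image in Fbar[G] of alpha in F(chi):
   \sum_s s(alpha) (chi(1) / |G|) \sum_g s(chi(g^-1)) g, s in Gal(F(chi) / F). *)
Definition centre_embed (chi : gT -> Fbar) (alpha : char_field chi) :
    'M[Fbar]_#|G| :=
  \sum_(s \in Gal (@to_char_field chi))
    (adjoin_val (s alpha) * (chi 1%g / #|G|%:R)) *: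
      \sum_(g in G) adjoin_val (s (char_val chi g^-1%g)) *: regular_repr Fbar G g.

(* The image in F[G] of a subset \bigoplus_i I i of \bigoplus_i F(chi i) under
   the identification of \bigoplus_i F(chi i) with the centre of F[G]. *)
Definition centre_sum (k : nat) (chi : 'I_k -> gT -> Fbar)
    (I : forall i, set (char_field (chi i))) : set 'M[F]_#|G| :=
  [set x : 'M[F]_#|G| | grp_alg F G x /\
     exists2 alpha : (forall i, char_field (chi i)),
       forall i, I i (alpha i) &
       map_mx iota x = \sum_(i < k) centre_embed (alpha i)].

End Characters.

Arguments char_int {F Fbar} iota {gT} G o chi.
Arguments char_ideal {F Fbar} iota {gT} G o chi.
Arguments conductor_summand {F Fbar} iota {gT} G o chi.

(* Main.v *)
Require Import Defs.
From HB Require Import structures.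
From mathcomp Require Import all_boot all_order all_algebra all_fingroup.
From mathcomp Require Import pgroup separable cyclotomic mxrepresentation.
From mathcomp Require Import ring.
From mathcomp Require Import boolp classical_sets functions cardinality fsbigop.

(* For x in the centre of F[G], let x_i in F_i be its component at chi_i: the
   scalar by which x acts on a representation affording chi_i.  Orthogonality
   and Maschke's theorem show that x is determined by the x_i, and its
   coefficient at g is the sum over i of Tr (x_i chi_i(1) / |G| chi_i(g^-1)).
   The centre of Lambda' consists of the x with every x_i integral: if z is
   central with integral components, then Lambda'[z] is an order, hence equal to
   Lambda'.  Testing x against central elements supported at one component i
   shows that x lies in the conductor iff x_i chi_i(1) / |G| chi_i(g) lies in the
   inverse different for all g and i, that is, iff multiplication by
   x_i chi_i(1) / |G| maps A_i into the inverse different.  As A_i is invertible,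
   this is the claim.

   Invertibility of A_i: let f be a polynomial whose coefficients are the
   chi_i(g), and write its norm to F[X] as f h, with content c in F.  By Dedekind's
   Prague theorem the coefficients of h / c lie in the inverse of A_i, and some
   coefficient of f (h / c) is 1. *)

Set Implicit Arguments.
Unset Strict Implicit.
Unset Printing Implicit Defensive.

Import Order.TTheory GRing.Theory Num.Theory.

Local Open Scope classical_set_scope.
Local Open Scope ring_scope.

(** Elements of [Gal] are bare functions; bundling them makes the theory of ring morphisms
    applicable. *)
Lemma rmorphism_of (R S : pzRingType) (s : R -> S) :
  zmod_morphism s -> monoid_morphism s ->
  exists f : {rmorphism R -> S}, forall x, f x = s x.
Proof.
move=> sB sM; pose sm := GRing.isZmodMorphism.Build _ _ s sB.
pose mm := GRing.isMonoidMorphism.Build _ _ s sM.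
pose f : {rmorphism R -> S} := HB.pack s sm mm.
by exists f.
Qed.

(** * Automorphisms of the algebraic closure: extension of partial ones, and their fixed field *)

Section PartialAutomorphisms.
Variables (F : fieldType) (K : closedFieldType) (iota : {rmorphism F -> K}).
Hypothesis Halg : is_alg_closure iota.

(* The graph of a ring homomorphism over F from a subring of K to K. *)
Record partial_aut (R : set (K * K)) : Prop := PartialAut {
  paut_base : forall a, R (iota a, iota a);
  paut_sub : forall x y, R x -> R y -> R (x - y);
  paut_mul : forall x y, R x -> R y -> R (x * y);
  paut_fun : forall y, R (0, y) -> y = 0
}.

Section Fixed.
Variable R : set (K * K).
Hypothesis PR : partial_aut R.

Lemma paut0 : R 0.
Proof. by have := paut_base PR 0; rewrite !rmorph0. Qed.

Lemma paut1 : R 1.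
Proof. by have := paut_base PR 1; rewrite !rmorph1. Qed.

Lemma paut_opp x : R x -> R (- x).
Proof. by move=> Rx; rewrite -sub0r; apply: paut_sub => //; apply: paut0. Qed.

Lemma paut_add x y : R x -> R y -> R (x + y).
Proof.
by move=> Rx Ry; rewrite -[y]opprK; apply: paut_sub => //; apply: paut_opp.
Qed.

Lemma paut_sum I (r : seq I) (P : pred I) (f : I -> K * K) :
  (forall i, P i -> R (f i)) -> R (\sum_(i <- r | P i) f i).
Proof. by move=> Rf; apply: big_ind => //; [apply: paut0 | apply: paut_add]. Qed.

Lemma paut_exp x n : R x -> R (x ^+ n).
Proof.
move=> Rx; elim: n => [|n IH]; first by rewrite expr0; apply: paut1.
by rewrite exprS; apply: paut_mul.
Qed.

(** The inverse of [c.1] is a root of a monic q over F of degree n + 1, so it equals minus the sum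
    of the q_i [c.1]^(n - i) over i <= n. The same polynomial expression in the pair [c] lies in R
    and has the right first component; single-valuedness at 0 settles the second. *)
Lemma paut_inv c : R c -> c.1 != 0 -> exists2 d, R d & c * d = 1.
Proof.
move=> Rc nz; have /integral_algebraic/integral_inv[q mq q0] := Halg c.1.
have sq : size q = (size q).-1.+1 by rewrite prednK // size_poly_gt0 monic_neq0.
have {sq} [n sq] : exists n, size q = n.+2.
  case: (size q).-1 sq => [sq|n ->]; last by exists n.
  have /size_poly1P[a a0 qa] : size q == 1%N by rewrite sq.
  by move: q0; rewrite qa map_polyC rootC fmorph_eq0 (negPf a0).
pose d : K * K := - \sum_(i < n.+1) (iota q`_i, iota q`_i) * c ^+ (n - i).
have Rd : R d.
  apply: paut_opp; apply: paut_sum => i _.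
  by apply: paut_mul => //; [apply: paut_base | apply: paut_exp].
have fstX m : (c ^+ m).1 = c.1 ^+ m.
  by elim: m => [|m IH] //; rewrite !exprS /= IH.
have d1 : d.1 = c.1^-1.
  rewrite /d /= raddf_sum /=.
  have q1 : (map_poly iota q)`_n.+1 = 1.
    have := monicP (monic_map iota mq); rewrite lead_coefE size_map_poly sq; exact.
  move: q0; rewrite rootE horner_coef size_map_poly sq big_ord_recr /= q1.
  rewrite mul1r addrC addr_eq0 => /eqP q0.
  apply: (@mulIf _ (c.1 ^- n)); first by rewrite invr_eq0 expf_neq0.
  rewrite -exprVn -exprS q0 mulNr mulr_suml; congr (- _).
  apply: eq_bigr => i _; rewrite coef_map /= fstX -mulrA; congr (_ * _).
  have -> : c.1^-1 ^+ n = c.1^-1 ^+ (n - i) * c.1^-1 ^+ i.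
    by rewrite -exprD subnK // leq_ord.
  by rewrite mulrA -exprMn divff // expr1n mul1r.
clearbody d; have e1 : (c * d).1 = 1.
  by change (c.1 * d.1 = 1); rewrite d1 divff.
exists d => //; have : R (c * d - 1).
  by apply: paut_sub => //; [apply: paut_mul | apply: paut1].
have -> : c * d - 1 = (0, (c * d).2 - 1).
  rewrite [LHS]surjective_pairing; congr pair.
  by change ((c * d).1 - 1 = 0); rewrite e1 subrr.
move/(paut_fun PR)/eqP; rewrite subr_eq0 => /eqP e2.
by rewrite [LHS]surjective_pairing e1 e2.
Qed.

(** M is the minimal polynomial of x over the domain of R, carried as a polynomial in pairs, and y
    is a root of its image under R. The extension consists of the values P(x, y) of the polynomials
    P over R. *)
Lemma paut_adjoin x : exists R', [/\ partial_aut R', R `<=` R' & exists y, R' (x, y)].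
Proof.
pose over (P : {poly K * K}) := forall i, R P`_i.
pose e1 (P : {poly K * K}) := (map_poly fst P).[x].
have exM : exists n, `[< exists M, [/\ over M, M \is monic, e1 M = 0 & size M = n] >].
  have /integral_algebraic[q mq q0] := Halg x.
  pose D a : K * K := (iota a, iota a).
  have D0 : D 0 = 0 by rewrite /D rmorph0.
  have qc i : (map_poly D q)`_i = D q`_i by rewrite coef_map_id0.
  exists (size (map_poly D q)); apply/asboolP; exists (map_poly D q); split=> //.
  - by move=> i; rewrite qc; apply: paut_base.
  - have sz : size (map_poly D q) = size q.
      apply: size_poly_eq; rewrite -lead_coefE (eqP mq) /D rmorph1; exact: oner_neq0.
    by rewrite monicE lead_coefE sz qc -lead_coefE (eqP mq) /D rmorph1.
  - rewrite /e1; move/rootP: q0 => <-; congr (_.[x]).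
    by apply/polyP => i; rewrite coef_map /= qc coef_map.
have [_ /asboolP[M [oM mM M0 <-]] minM] := ex_minnP exM.
have szM : size (map_poly snd M) = size M.
  by apply: size_poly_eq; rewrite -lead_coefE (eqP mM); exact: oner_neq0.
have /closed_rootP[y y0] : size (map_poly snd M) != 1%N.
  rewrite szM; apply/negP => /eqP/eqP/size_poly1P[a a0 Ma].
  move: mM M0; rewrite /e1 Ma monicE lead_coefC => /eqP ->.
  by rewrite rmorph1 hornerC => /eqP; rewrite oner_eq0.
pose e2 (P : {poly K * K}) := (map_poly snd P).[y].
have eE (P : {poly K * K}) : P.[(x, y)] = (e1 P, e2 P).
  by rewrite [LHS]surjective_pairing /e1 /e2 -!horner_map.
(* Single-valuedness of the extension. Division by M, one leading term at a time, lowers the size of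
   P; a nonzero P smaller than M could be made monic, against the minimality of M. *)
have fun_over : forall n (P : {poly K * K}), (size P < n)%N -> over P -> e1 P = 0 -> e2 P = 0.
  elim=> // n IH P; rewrite ltnS => sP oP P0.
  have [->|nzP] := eqVneq P 0; first by rewrite /e2 rmorph0 hornerC.
  have RlP : R (lead_coef P) by rewrite lead_coefE; apply: oP.
  have [lt|le] := ltnP (size P) (size M).
    (* The leading coefficient is a nonzero pair; as R is single-valued at 0, its first component is
       already nonzero. *)
    have nzl : (lead_coef P).1 != 0.
      apply/negP => /eqP l0; have := nzP; rewrite -lead_coef_eq0.
      rewrite [lead_coef P]surjective_pairing l0.
      by rewrite (paut_fun PR (y := (lead_coef P).2)) ?eqxx // -l0 -surjective_pairing.
    have [d Rd cd] := paut_inv RlP nzl.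
    have nz1 : lead_coef P * d != 0 by rewrite cd oner_neq0.
    have coeffd i : (P * d%:P)`_i = P`_i * d by rewrite coefMC.
    (* [K * K] has zero divisors, so the size of the product is read off from its top coefficient,
       which is 1. *)
    have szd : size (P * d%:P) = size P.
      apply/eqP; rewrite eqn_leq; apply/andP; split.
        by apply/leq_sizeP => j hj; rewrite coeffd nth_default ?mul0r.
      rewrite leqNgt -[X in (_ < X)%N]prednK ?size_poly_gt0 // ltnS.
      apply/negP => /leq_sizeP/(_ _ (leqnn _)); rewrite coeffd -lead_coefE cd.
      by move/eqP; rewrite oner_eq0.
    have := minM (size (P * d%:P)); rewrite szd leqNgt lt => H; suff: false by [].
    apply: H; apply/asboolP; exists (P * d%:P); split=> //.
    - by move=> i; rewrite coeffd; apply: paut_mul.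
    - by rewrite monicE lead_coefE szd coeffd -lead_coefE cd.
    - by rewrite /e1 rmorphM /= hornerM; rewrite /e1 in P0; rewrite P0 mul0r.
  pose Q := (lead_coef P)%:P * ('X^(size P - size M) * M).
  have oQ : over Q.
    move=> i; rewrite coefCM; apply: paut_mul => //; rewrite coefXnM.
    by case: ifP => _; [apply: paut0 | apply: oM].
  have szQ : (size (P - Q)%R < size P)%N.
    rewrite -[X in (_ < X)%N]prednK ?size_poly_gt0 // ltnS.
    apply/leq_sizeP => j; rewrite leq_eqVlt coefB coefCM coefXnM => /orP[/eqP <-|lt].
      have hM : (0 < size M)%N by rewrite size_poly_gt0 monic_neq0.
      have le' : ((size P).-1 < size P - size M)%N = false.
        apply/negbTE; rewrite -leqNgt -subn1; exact: leq_sub2l.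
      rewrite le'; have -> : ((size P).-1 - (size P - size M) = (size M).-1)%N.
        by rewrite -!subn1 subnAC subKn.
      by rewrite -!lead_coefE (eqP mM) mulr1 subrr.
    have hj : (size P <= j)%N by move: lt; rewrite prednK ?size_poly_gt0.
    rewrite (nth_default _ hj); case: ifP => _; first by rewrite mulr0 subr0.
    rewrite (nth_default 0 (s := M)) ?mulr0 ?subr0 //.
    by rewrite leq_subRL ?(leq_trans (leq_subr _ _)) // subnK.
  have Mz : M.[(x, y)] = 0 by rewrite eE M0 /e2 (rootP y0).
  have : (P - Q).[(x, y)] = P.[(x, y)].
    by rewrite hornerD hornerN /Q !hornerM Mz !mulr0 subr0.
  rewrite !eE => -[E1 <-]; apply: IH; first exact: leq_trans szQ sP.
    by move=> i; rewrite coefB; apply: paut_sub.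
  by rewrite E1.
exists [set z | exists2 P, over P & z = P.[(x, y)]]; split.
- split.
  + move=> a; exists (iota a, iota a)%:P; last by rewrite hornerC.
    by move=> i; rewrite coefC; case: ifP => _; [apply: paut_base | apply: paut0].
  + move=> _ _ [P oP ->] [Q oQ ->]; exists (P - Q); last by rewrite hornerD hornerN.
    by move=> i; rewrite coefB; apply: paut_sub.
  + move=> _ _ [P oP ->] [Q oQ ->]; exists (P * Q); last by rewrite hornerM.
    by move=> i; rewrite coefM; apply: paut_sum => j _; apply: paut_mul.
  + move=> z [P oP]; rewrite eE => -[/esym h1 ->].
    exact: (fun_over (size P).+1).
- move=> z Rz; exists z%:P; last by rewrite hornerC.
  by move=> i; rewrite coefC; case: ifP => _ //; apply: paut0.
- exists y; exists 'X; last by rewrite hornerX.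
  by move=> i; rewrite coefX; case: eqP => _; [apply: paut1 | apply: paut0].
Qed.

End Fixed.

(** Every y is a root of some polynomial over F; s maps the finite set of its roots injectively into
    itself, so y is in the image. *)
Lemma algebraic_endo_bij (s : K -> K) : zmod_morphism s -> monoid_morphism s ->
  (forall a, s (iota a) = iota a) -> bijective s.
Proof.
move=> sB sM sF; have [f fE] := rmorphism_of sB sM.
have inj : injective s by move=> x y; rewrite -!fE => /fmorph_inj.
have surj y : exists x, s x = y.
  have [p nzp py] := Halg y.
  have [rs prs] := closed_field_poly_normal (map_poly iota p).
  have nzl : lead_coef (map_poly iota p) != 0.
    by rewrite lead_coef_eq0 map_poly_eq0.
  have rsP x : (x \in undup rs) = root (map_poly iota p) x.
    by rewrite mem_undup prs rootZ // root_prod_XsubC.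
  have sub : {subset map s (undup rs) <= undup rs}.
    move=> _ /mapP[x xr ->]; move: xr; rewrite !rsP => /rootP h.
    have -> : map_poly iota p = map_poly f (map_poly iota p).
      by rewrite -map_poly_comp; apply: eq_map_poly => a /=; rewrite fE sF.
    by rewrite -fE rootE horner_map h rmorph0.
  have u : uniq (map s (undup rs)) by rewrite map_inj_uniq ?undup_uniq.
  have [_ e] := uniq_min_size u sub (eq_leq (esym (size_map s (undup rs)))).
  have : y \in map s (undup rs) by rewrite e rsP.
  by case/mapP => x _ ->; exists x.
have [t st] := choice surj.
by exists t => x //; apply: inj; rewrite st.
Qed.

(** By Zorn's lemma R lies in a maximal partial automorphism. It is defined on all of K by
    [paut_adjoin], and then bijective because K is algebraic over F. *)
Lemma extend_partial_aut (R : set (K * K)) : partial_aut R ->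
  exists2 s, Gal iota s & forall x y, R (x, y) -> s x = y.
Proof.
move=> PR.
pose P := [set A : set (K * K) | A = set0 \/ (partial_aut A /\ R `<=` A)].
have [|A [PA maxA]] := @Zorn_bigcup _ P.
- move=> C CP tot.
  case: (pselect (exists2 A, C A & A !=set0)) => [[A0 CA0 nA0]|none]; last first.
    by left; rewrite -subset0 => z [A CA Az]; apply: none; exists A => //; exists z.
  right; have prop A : C A -> A !=set0 -> partial_aut A /\ R `<=` A.
    by move=> /CP[->|//] [].
  have [PA0 RA0] := prop _ CA0 nA0.
  have two x y : (\bigcup_(X in C) X) x -> (\bigcup_(X in C) X) y ->
      exists A, [/\ C A, partial_aut A, A x & A y].
    move=> [A CA Ax] [B CB By].
    have [pA _] := prop _ CA (ex_intro _ x Ax).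
    have [pB _] := prop _ CB (ex_intro _ y By).
    have [h|h] := tot _ _ CA CB; [exists B|exists A]; split=> //; exact: h.
  split; last by move=> z Rz; exists A0 => //; apply: RA0.
  split.
  + by move=> a; exists A0 => //; apply: paut_base.
  + move=> x y Ux Uy; have [A [CA pA Ax Ay]] := two _ _ Ux Uy.
    by exists A => //; apply: paut_sub.
  + move=> x y Ux Uy; have [A [CA pA Ax Ay]] := two _ _ Ux Uy.
    by exists A => //; apply: paut_mul.
  + by move=> y U; have [A [_ pA Ay _]] := two _ _ U U; apply: (paut_fun pA).
have {}PA : partial_aut A /\ R `<=` A.
  case: PA => // A0; case: (maxA R); last by right; split.
  by rewrite A0; split=> // h; have /h : R (iota 0, iota 0) by apply: paut_base.
case: PA => PA RA.
have tot x : exists y, A (x, y).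
  have [B [PB AB [y Bxy]]] := paut_adjoin PA x.
  exists y; apply: contrapT => nA; apply: (maxA B); last first.
    by right; split=> // z /RA; apply: AB.
  by split=> // h; apply: nA; apply: h.
have Afun x y z : A (x, y) -> A (x, z) -> y = z.
  move=> Ay Az; apply/eqP; rewrite -subr_eq0; apply/eqP; apply: (paut_fun PA).
  by have := paut_sub PA Ay Az; congr (A _); congr (_, _); apply: subrr.
have [s As] := choice tot.
have sB : zmod_morphism s by move=> x y; apply: (Afun (x - y)) => //; apply: (paut_sub PA (As x) (As y)).
have sM : monoid_morphism s.
  split; first by apply: (Afun 1) => //; exact: (paut1 PA).
  by move=> x y; apply: (Afun (x * y)) => //; apply: (paut_mul PA (As x) (As y)).
have sF a : s (iota a) = iota a by apply: (Afun (iota a)) => //; apply: (paut_base PA).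
exists s; last by move=> x y /RA; apply: Afun.
by split=> //; apply: algebraic_endo_bij.
Qed.

End PartialAutomorphisms.

(** Let m be of least size among the nonzero polynomials over F that vanish at x. If m is not
    linear, it has a second root y, and p(x) |-> p(y) is a partial automorphism; its extension to K
    moves x. *)
Lemma Gal_fixed_base (F : fieldType) (K : closedFieldType)
    (iota : {rmorphism F -> K}) (Halg : is_alg_closure iota)
    (char0 : [pchar F] =i pred0) (x : K) :
  (forall s, Gal iota s -> s x = x) -> exists a, x = iota a.
Proof.
move=> fix_x.
have exm : exists n, `[< exists m : {poly F}, [/\ m != 0, root (map_poly iota m) x & size m = n] >].
  by have [m nzm mx] := Halg x; exists (size m); apply/asboolP; exists m.
have [_ /asboolP[m [nzm mx <-]] minm] := ex_minnP exm.
have {}minm p : root (map_poly iota p) x -> (size p < size m)%N -> p = 0.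
  move=> px; rewrite ltnNge => /negP h; apply/eqP; apply: contraT => nzp.
  by case: h; apply: minm; apply/asboolP; exists p.
have nzmx : map_poly iota m != 0 by rewrite map_poly_eq0.
have m1 : (1 < size m)%N.
  rewrite ltnNge; apply/negP => /size1_polyC mE; move: mx nzm.
  by rewrite mE map_polyC rootC fmorph_eq0 => /eqP ->; rewrite eqxx.
have [q mq] := factor_theorem (map_poly iota m) x mx.
have [m2|m2] := eqVneq (size m) 2.
  exists (- m`_0 / m`_1).
  have l1 : m`_1 != 0 by have := nzm; rewrite -lead_coef_eq0 lead_coefE m2.
  move/rootP: mx; rewrite horner_coef size_map_poly m2 big_ord_recr big_ord1 /=.
  rewrite !coef_map /= expr0 mulr1 expr1 addrC => /eqP; rewrite addr_eq0 => /eqP h.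
  by rewrite fmorph_div rmorphN -h mulrC mulKf // fmorph_eq0.
have szq : size q = (size m).-1.
  by rewrite -(size_map_poly iota m) mq size_Mmonic ?monicXsubC // ?size_XsubC ?addn2 //;
     apply: contraNneq nzmx => q0; rewrite mq q0 mul0r.
(* A double root would also be a root of the derivative of m, which in characteristic zero is
   nonzero and smaller than m. *)
have qx : ~~ root q x.
  apply/negP => /rootP qx.
  have /minm dm : root (map_poly iota m^`()) x.
    by rewrite -deriv_map mq rootE derivM derivXsubC mulr1 hornerD hornerM hornerXsubC subrr mulr0 add0r qx.
  have := lt_size_deriv nzm => /dm /polyP/(_ (size m).-2).
  rewrite coef_deriv coef0 => /eqP; rewrite -mulr_natr mulf_eq0 ((pcharf0P F).1 char0) orbF.
  have -> : (size m).-2.+1 = (size m).-1 by case: (size m) m1 => [|[|n]].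
  by rewrite -lead_coefE lead_coef_eq0 (negPf nzm).
have /closed_rootP[y qy] : size q != 1%N by rewrite szq; case: (size m) m1 m2 => [|[|[|n]]].
pose R := [set z | exists p : {poly F}, z = ((map_poly iota p).[x], (map_poly iota p).[y])].
have PR : partial_aut iota R.
  split.
  - by move=> a; exists a%:P; rewrite !map_polyC !hornerC.
  - by move=> _ _ [p ->] [r ->]; exists (p - r); rewrite rmorphB !hornerD !hornerN.
  - by move=> _ _ [p ->] [r ->]; exists (p * r); rewrite rmorphM !hornerM.
  - move=> z [p [h ->]]; have pm : m %| p.
      rewrite /dvdp; apply/eqP; apply: minm; last by rewrite ltn_modp.
      have := divp_eq p m => /(congr1 (fun p => (map_poly iota p).[x])).
      rewrite -h rmorphD rmorphM hornerD hornerM (rootP mx) mulr0 add0r => h'.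
      by rewrite rootE -h'.
    have [r ->] := dvdpP _ _ pm.
    by rewrite rmorphM /= mq !hornerM (rootP qy) !(mulr0, mul0r).
have [s Gs sR] := extend_partial_aut Halg PR.
have /sR sx : R (x, y) by exists 'X; rewrite map_polyX !hornerX.
by move: qx; rewrite -(fix_x s Gs) sx qy.
Qed.

(** * Subfields generated over F, and groups of automorphisms over F *)

Section AdjoinTheory.
Variables (F K : fieldType) (iota : {rmorphism F -> K}) (S : set K).
Local Notation E := (adjoin iota S).
Local Notation f := (@in_adjoin F K iota S).

Definition adjoin_emb : {rmorphism E -> K} := \val.

Lemma adjoin_embE (x : E) : adjoin_val x = adjoin_emb x.
Proof. by []. Qed.

Lemma adjoin_emb_base a : adjoin_emb (f a) = iota a.
Proof. by []. Qed.

Lemma adjoin_emb_inj : injective adjoin_emb.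
Proof. exact: val_inj. Qed.

Fact in_adjoin_zmod_morphism : zmod_morphism f.
Proof. by move=> a b; apply: adjoin_emb_inj; rewrite !rmorphB !adjoin_emb_base rmorphB. Qed.

Fact in_adjoin_monoid_morphism : monoid_morphism f.
Proof.
split=> [|a b]; apply: adjoin_emb_inj.
  by rewrite rmorph1 adjoin_emb_base rmorph1.
by rewrite !rmorphM !adjoin_emb_base rmorphM.
Qed.

HB.instance Definition _ :=
  GRing.isZmodMorphism.Build F E f in_adjoin_zmod_morphism.
HB.instance Definition _ :=
  GRing.isMonoidMorphism.Build F E f in_adjoin_monoid_morphism.

Lemma adjoin_memP (x : K) : reflect (exists e : E, adjoin_emb e = x) (x \in adjoin_pred iota S).
Proof.
apply: (iffP idP) => [Sx|[[y Sy] <-] //]; by exists (Adjoin Sx).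
Qed.

(** The elements where s and t agree form a subfield, one of the sets D over which [adjoin_pred]
    quantifies. *)
Lemma adjoin_eq_on_gen (L : fieldType) (s t : {rmorphism E -> L}) :
  (forall a, s (f a) = t (f a)) ->
  (forall e, S (adjoin_emb e) -> s e = t e) -> s =1 t.
Proof.
move=> sF sS e.
pose D : {pred K} := fun x => `[< exists2 e, adjoin_emb e = x & s e = t e >].
have: adjoin_emb e \in D; last first.
  by move/asboolP => [e' /adjoin_emb_inj <-].
have := valP e => /asboolP; apply.
- split.
  + by apply/asboolP; exists 1; rewrite !rmorph1.
  + move=> _ _ /asboolP[x <- xE] /asboolP[y <- yE]; apply/asboolP.
    by exists (x - y); rewrite !rmorphB // xE yE.
  + move=> _ _ /asboolP[x <- xE] /asboolP[y <- yE]; apply/asboolP.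
    by exists (x / y); rewrite !fmorph_div // xE yE.
- by move=> a; apply/asboolP; exists (f a).
- move=> x Sx; apply/asboolP; exists (Adjoin (adjoin_gen iota Sx)) => //.
  exact: sS.
Qed.

End AdjoinTheory.

(** An enumeration of [Gal f], meaningful once that set is known to be finite; for character fields
    this is [Gal_char_field_finite]. *)
Definition Gal_seq (F E : fieldType) (f : F -> E) : seq (E -> E) :=
  finmap.enum_fset (fset_set (Gal f)).

Section AutomorphismGroup.
Variables (F E : fieldType) (f : {rmorphism F -> E}).

Lemma Gal_rmorph s : Gal f s -> exists t : {rmorphism E -> E}, forall x, t x = s x.
Proof. by case=> sB sM _ _; apply: rmorphism_of. Qed.

Lemma Gal_id : Gal f id.
Proof. by split=> //; exists id. Qed.

Lemma Gal_comp s t : Gal f s -> Gal f t -> Gal f (s \o t).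
Proof.
move=> Gs Gt; have [_ _ bs fs] := Gs; have [_ _ bt ft] := Gt.
have [s' sE] := Gal_rmorph Gs; have [t' tE] := Gal_rmorph Gt.
split; last by move=> a /=; rewrite ft fs.
- by move=> x y /=; rewrite -!tE -!sE !rmorphB.
- by split=> [|x y] /=; rewrite -!tE -!sE ?rmorph1 ?rmorphM.
- exact: bij_comp.
Qed.

Lemma Gal_inv s : Gal f s -> exists t, [/\ Gal f t, cancel s t & cancel t s].
Proof.
move=> Gs; have [_ _ [t st ts] fs] := Gs; have [s' sE] := Gal_rmorph Gs.
have inj : injective s' by move=> x y; rewrite !sE => /(can_inj st).
have ts' x : s' (t x) = x by rewrite sE ts.
exists t; split=> //; split.
- by move=> x y; apply: inj; rewrite rmorphB !ts'.
- by split=> [|x y]; apply: inj; rewrite ?rmorph1 ?rmorphM !ts'.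
- by exists s.
- by move=> a; rewrite -{1}(fs a) st.
Qed.

End AutomorphismGroup.

(** * Galois theory of the field F(chi) *)

Section CharFieldGalois.
Variables (F : fieldType) (K : closedFieldType) (iota : {rmorphism F -> K}).
Hypotheses (Halg : is_alg_closure iota) (char0 : [pchar F] =i pred0).
Variables (gT : finGroupType) (G : {group gT}) (chi : gT -> K).
Hypothesis chi_stable : forall s, Gal iota s ->
  exists h : gT -> gT, forall g, g \in G -> h g \in G /\ s (chi g) = chi (h g).

Local Notation S := [set chi g | g in [set` G]].
Local Notation E := (adjoin iota S).
Local Notation emb := (adjoin_emb iota S).
Local Notation f := (@in_adjoin F K iota S).
Local Notation cv := (char_val iota G chi : gT -> E).

Lemma emb_char_val g : g \in G -> emb (cv g) = chi g.
Proof. exact: (char_valE iota chi). Qed.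

(** The graph of s, read inside K, is a partial automorphism. *)
Lemma Gal_char_field_ext s : Gal f s ->
  exists2 t, Gal iota t & forall e, t (emb e) = emb (s e).
Proof.
move=> Gs; have [s' sE] := Gal_rmorph (f := in_adjoin iota S) Gs.
pose R := [set z | exists e : E, z = (emb e, emb (s' e))].
have PR : partial_aut iota R.
  split.
  - by move=> a; exists (f a); rewrite sE; case: Gs => _ _ _ ->.
  - by move=> _ _ [x ->] [y ->]; exists (x - y); rewrite !rmorphB.
  - by move=> _ _ [x ->] [y ->]; exists (x * y); rewrite !rmorphM.
  - move=> y [e [h ->]]; have -> : e = 0 by apply: adjoin_emb_inj; rewrite rmorph0; exact: esym h.
    by rewrite !rmorph0.
have [t Gt tR] := extend_partial_aut Halg PR.
by exists t => // e; rewrite -sE; apply: tR; exists e.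
Qed.

(** This is the normality of F(chi) over F: by [chi_stable] the preimage of F(chi) under s is a
    subfield that contains all values of chi. *)
Lemma Gal_restr_closed s : Gal iota s -> forall e, exists e', emb e' = s (emb e).
Proof.
move=> Gs e; apply/adjoin_memP; have [s' sE] := Gal_rmorph Gs.
pose D : {pred K} := [pred x | s' x \in adjoin_pred iota S].
have DE x : (x \in D) = (s' x \in adjoin_pred iota S) by [].
rewrite -sE -DE.
have := valP e => /asboolP; apply.
- have [c1 c2 c3] := adjoin_closed iota S.
  split; rewrite ?DE ?rmorph1 //.
  + by move=> x y; rewrite !DE rmorphB; apply: c2.
  + by move=> x y; rewrite !DE fmorph_div; apply: c3.
- move=> a; rewrite DE sE; case: Gs => _ _ _ ->; exact: adjoin_base.
- move=> _ [g Gg <-]; rewrite DE sE; have [h hP] := chi_stable Gs.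
  by have [Gh ->] := hP g Gg; apply: adjoin_gen; exists (h g).
Qed.

Lemma Gal_restr s : Gal iota s -> exists2 t, Gal f t & forall e, emb (t e) = s (emb e).
Proof.
move=> Gs; have [s1 [Gs1 s1K sK1]] := Gal_inv Gs.
have [t tE] := choice (Gal_restr_closed Gs).
have [t1 t1E] := choice (Gal_restr_closed Gs1).
have [s' sE] := Gal_rmorph Gs.
have inj := @adjoin_emb_inj F K iota S.
exists t => //; split.
- by move=> x y; apply: inj; rewrite !rmorphB !tE !rmorphB -!sE rmorphB.
- by split=> [|x y]; apply: inj; rewrite ?rmorph1 ?rmorphM !tE ?rmorph1 ?rmorphM -!sE ?rmorph1 ?rmorphM.
- by exists t1 => x; apply: inj; rewrite ?(tE, t1E) ?s1K ?sK1.
- by move=> a; apply: inj; rewrite tE adjoin_emb_base; case: Gs.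
Qed.

(** Automorphisms of K restrict to F(chi), so x is fixed by all of them. *)
Lemma Gal_char_field_fixed (x : E) : (forall s, Gal f s -> s x = x) -> exists a, x = f a.
Proof.
move=> fx; have [|a xa] := Gal_fixed_base Halg char0 (x := emb x).
  by move=> s /Gal_restr[t Gt tE]; rewrite -tE fx.
by exists a; apply: adjoin_emb_inj; rewrite xa.
Qed.

Lemma Gal_char_field_inj s t : Gal f s -> Gal f t ->
  {in G, forall g, s (cv g) = t (cv g)} -> s = t.
Proof.
move=> Gs Gt st; have [s' sE] := Gal_rmorph (f := in_adjoin iota S) Gs.
have [t' tE] := Gal_rmorph (f := in_adjoin iota S) Gt.
apply/funext => x; rewrite -sE -tE; apply: adjoin_eq_on_gen.
  by move=> a; rewrite sE tE; case: Gs => _ _ _ ->; case: Gt => _ _ _ ->.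
move=> e [g Gg ge]; rewrite sE tE.
have <- : cv g = e by apply: adjoin_emb_inj; rewrite emb_char_val.
exact: st.
Qed.

Lemma Gal_char_val s : Gal f s -> exists h : gT -> gT,
  forall g, g \in G -> h g \in G /\ s (cv g) = cv (h g).
Proof.
move=> /Gal_char_field_ext[t Gt tE]; have [h hP] := chi_stable Gt.
exists h => g Gg; have [Gh e] := hP g Gg; split=> //.
by apply: adjoin_emb_inj; rewrite -tE !emb_char_val.
Qed.

(** An automorphism is determined by a map h on the group that describes its effect on the values of
    chi, and there are finitely many such maps. *)
Lemma Gal_char_field_finite : finite_set (Gal f).
Proof.
pose P (h : {ffun gT -> gT}) (s : E -> E) := Gal f s /\ {in G, forall g, s (cv g) = cv (h g)}.
(* A choice of an automorphism with effect h; the default [id] stands for the h that belong to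
   none. *)
pose T h : E -> E := if pselect (exists s, P h s) is left e then projT1 (cid e) else id.
apply: (@sub_finite_set _ _ (T @` setT)); last exact/finite_image/finite_finset.
move=> s Gs; have [h hP] := Gal_char_val Gs.
have Ph : P [ffun g => h g] s.
  by split=> // g Gg; rewrite ffunE; case: (hP g Gg).
exists [ffun g => h g] => //; rewrite /T; case: pselect => [ex|[]]; last by exists s.
case: cid => t [/= Gt tP]; apply: Gal_char_field_inj => // g Gg.
by rewrite tP //; case: Ph => _ ->.
Qed.

Lemma Gal_seq_uniq : uniq (Gal_seq f).
Proof. exact: finmap.fset_uniq. Qed.

Lemma mem_Gal_seq s : (s \in (Gal_seq f)) <-> Gal f s.
Proof.
rewrite /Gal_seq (in_fset_set Gal_char_field_finite).
by split=> [/set_mem|/mem_set].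
Qed.

Lemma sum_GalE (V : nmodType) (phi : (E -> E) -> V) :
  \sum_(s \in Gal f) phi s = \sum_(s <- (Gal_seq f)) phi s.
Proof. exact: fsbig_finite Gal_char_field_finite. Qed.

Lemma Gal_seq_comp t : Gal f t -> perm_eq [seq t \o s | s <- (Gal_seq f)] (Gal_seq f).
Proof.
move=> Gt; have inj : injective (fun s : E -> E => t \o s).
  move=> s s' e; apply/funext => x; have [_ _ /bij_inj it _] := Gt; apply: it.
  by have := congr1 (fun u => u x) e.
have u : uniq [seq t \o s | s <- (Gal_seq f)] by rewrite map_inj_uniq ?Gal_seq_uniq.
apply: uniq_perm => //; first exact: Gal_seq_uniq.
have sub : {subset [seq t \o s | s <- (Gal_seq f)] <= (Gal_seq f)}.
  move=> _ /mapP[s /mem_Gal_seq Gs ->]; apply/mem_Gal_seq.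
  exact: (Gal_comp (f := in_adjoin iota S)).
by have [_] := uniq_min_size u sub (eq_leq (esym (size_map _ _))).
Qed.

Lemma Tr_char_fieldE (x : E) : Tr f x = \sum_(s <- (Gal_seq f)) s x.
Proof. exact: sum_GalE. Qed.

Lemma Tr_char_field_base (x : E) : exists a, Tr f x = f a.
Proof.
apply: Gal_char_field_fixed => t Gt; have [t' tE] := Gal_rmorph (f := in_adjoin iota S) Gt.
rewrite Tr_char_fieldE -tE rmorph_sum /=.
rewrite -[RHS](perm_big _ (Gal_seq_comp Gt)) big_map.
by apply: eq_bigr => s _; rewrite tE.
Qed.

Lemma Tr_char_fieldD (x y : E) : Tr f (x + y) = Tr f x + Tr f y.
Proof.
rewrite !Tr_char_fieldE -big_split /=; rewrite big_seq [RHS]big_seq.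
apply: eq_bigr => s /mem_Gal_seq Gs.
by have [s' sE] := Gal_rmorph (f := in_adjoin iota S) Gs; rewrite -!sE rmorphD.
Qed.

End CharFieldGalois.

(** * Schur's lemma, orthogonality of characters and Maschke's theorem *)

Section IrreducibleCharacters.
Variables (K : closedFieldType) (gT : finGroupType) (G : {group gT}).
Hypothesis char0 : [pchar K] =i pred0.

Lemma natr_neq0 n : (0 < n)%N -> n%:R != 0 :> K.
Proof. by rewrite ((pcharf0P K).1 char0) lt0n. Qed.

Section Schur.
Variables (n m : nat) (rG : mx_representation K G n) (rH : mx_representation K G m).
Hypotheses (irrG : mx_irreducible rG) (irrH : mx_irreducible rH).

Lemma irr_degree_gt0 : (0 < n)%N.
Proof. by case/mx_irrP: irrG. Qed.

Lemma irr_cent_scalar A : centgmx rG A -> exists a, A = a%:M.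
Proof.
have a_irr := group_closure_closed_field irrG.
by move=> /(mx_abs_irr_cent_scalar a_irr)/is_scalar_mxP.
Qed.

(** Schur's lemma: the kernel and the image of B are submodules of irreducible modules. *)
Lemma intertwiner_rsim (B : 'M_(n, m)) :
  {in G, forall x, rG x *m B = B *m rH x} -> B != 0 -> mx_rsim rG rH.
Proof.
move=> BJ nzB.
have freeB : row_free B.
  rewrite -kermx_eq0; apply: contraNT nzB => nzk.
  have [_ _ /(_ (kermx B))] := irrG; rewrite submx1 => /(_ _ isT nzk).
  move=> h; rewrite -(mul1mx B); apply/eqP/sub_kermxP; apply: h.
  apply/mxmoduleP => x Gx; apply/sub_kermxP.
  by rewrite -mulmxA BJ // mulmxA mulmx_ker mul0mx.
have fullB : row_full B.
  have [_ _ /(_ <<B>>%MS)] := irrH; rewrite submx1 -sub1mx !genmxE; apply=> //.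
    rewrite (eqmx_module _ (genmxE B)).
    by apply/mxmoduleP => x Gx; rewrite -BJ // submxMl.
  by rewrite (eqmx_eq0 (genmxE B)).
exists B => //; move: freeB fullB; by move=> /eqP rn /eqP rm; rewrite -[LHS]rn rm.
Qed.

(** The unnormalised average of X over G, which is an intertwiner from rG to rH. *)
Definition schur_avg (X : 'M_(n, m)) := \sum_(g in G) rG g *m X *m rH g^-1%g.

Lemma schur_avgJ X : {in G, forall x, rG x *m schur_avg X = schur_avg X *m rH x}.
Proof.
move=> x Gx; rewrite /schur_avg mulmx_sumr mulmx_suml.
rewrite [RHS](reindex_inj (mulgI x)) /=; apply: eq_big => [g|g Gg].
  by rewrite groupMl.
rewrite !mulmxA repr_mxM // -!mulmxA; congr (_ *m (_ *m (_ *m _))).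
by rewrite -repr_mxM ?groupV ?groupM // invMg mulgKV.
Qed.

Lemma schur_avg_nsim X : ~ mx_rsim rG rH -> schur_avg X = 0.
Proof.
move=> nsim; apply/eqP; apply: contraT => nz; case: nsim.
exact: intertwiner_rsim (@schur_avgJ X) nz.
Qed.

End Schur.

(** The average is a scalar by Schur's lemma, and taking traces determines it. *)
Lemma schur_avg_sim n (rG : mx_representation K G n) X : mx_irreducible rG ->
  schur_avg rG rG X = (#|G|%:R * \tr X / n%:R)%:M.
Proof.
move=> irrG; have [a aE] : exists a, schur_avg rG rG X = a%:M.
  by apply: (irr_cent_scalar irrG); apply/centgmxP => x Gx; rewrite schur_avgJ.
have nzn := natr_neq0 (irr_degree_gt0 irrG).
rewrite aE; congr (_%:M); apply: (mulIf nzn); rewrite mulfVK //.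
have := congr1 mxtrace aE; rewrite mxtrace_scalar => h; rewrite mulr_natr -h.
rewrite raddf_sum /= (eq_bigr (fun=> \tr X)) => [|g Gg].
  by rewrite sumr_const mulr_natl.
by rewrite mxtrace_mulC mulmxA -repr_mxM ?groupV // mulVg repr_mx1 mul1mx.
Qed.

(** With the matrix unit E_ij as X, the (a, j) entry of the term of g is the (a, i) entry of rG(g)
    times the (j, j) entry of rH(g^-1); summation over j produces the trace. *)
Lemma sum_mxtrace_scale n m (rG : mx_representation K G n)
    (rH : mx_representation K G m) a i :
  (\sum_(g in G) \tr (rH g^-1%g) *: rG g) a i =
  \sum_j schur_avg rG rH (delta_mx i j) a j.
Proof.
rewrite summxE; under [RHS]eq_bigr do rewrite /schur_avg summxE.
rewrite exchange_big /=; apply: eq_bigr => g Gg.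
rewrite mxE /mxtrace mulr_suml; apply: eq_bigr => j _.
rewrite mxE (bigD1 j) //= [X in _ = _ + X]big1 ?addr0 => [|l nl].
  rewrite mxE (bigD1 i) //= [X in _ + X]big1 ?addr0 => [|l nl].
    by rewrite !mxE !eqxx mulr1 mulrC.
  by rewrite !mxE (negPf nl) mulr0.
rewrite mxE big1 ?mul0r // => l' _.
by rewrite mxE (negPf nl) andbF mulr0.
Qed.

(** In other words, the central idempotent attached to the character acts as the identity on its own
    representation. *)
Lemma irr_char_sum_sim n (rG : mx_representation K G n) : mx_irreducible rG ->
  \sum_(g in G) \tr (rG g^-1%g) *: rG g = (#|G|%:R / n%:R)%:M.
Proof.
move=> irrG; apply/matrixP => a i; rewrite sum_mxtrace_scale.
under eq_bigr do rewrite schur_avg_sim // mxE.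
rewrite mxE (bigD1 a) //= [X in _ + X]big1 ?addr0 => [|j ja].
  rewrite eqxx mulr1n; have [->|ne] := eqVneq a i.
    rewrite mulr1n /mxtrace (bigD1 i) //= big1 ?mxE ?eqxx ?addr0 ?mulr1 // => j nj.
    by rewrite mxE (negPf nj).
  rewrite mulr0n /mxtrace big1 ?mulr0 ?mul0r // => j _; rewrite mxE.
  by case: eqP => // ->; rewrite (eq_sym i) (negPf ne) .
by rewrite eq_sym (negPf ja) mulr0n.
Qed.

Lemma irr_char_sum_nsim n m (rG : mx_representation K G n)
    (rH : mx_representation K G m) : mx_irreducible rG -> mx_irreducible rH ->
  ~ mx_rsim rG rH -> \sum_(g in G) \tr (rH g^-1%g) *: rG g = 0.
Proof.
move=> irrG irrH nsim; apply/matrixP => a i; rewrite sum_mxtrace_scale mxE.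
by apply: big1 => j _; rewrite schur_avg_nsim // mxE.
Qed.

Lemma irr_char_sum chi n (rG : mx_representation K G n) :
  irr_char G chi -> mx_irreducible rG ->
  \sum_(g in G) chi g^-1%g *: rG g =
    if `[< {in G, forall g, chi g = \tr (rG g)} >] then (#|G|%:R / n%:R)%:M else 0.
Proof.
move=> [m [rH [irrH chiE]]] irrG; case: asboolP => [h|h].
  rewrite -(irr_char_sum_sim irrG); apply: eq_bigr => g Gg.
  by rewrite h // groupV.
rewrite -[RHS](irr_char_sum_nsim irrG irrH).
  by apply: eq_bigr => g Gg; rewrite chiE // groupV.
by move=> /mxtrace_rsim sim; apply: h => g Gg; rewrite chiE // sim.
Qed.

(** By Maschke's theorem the regular module is a sum of simple submodules. A annihilates each of
    them, hence all row vectors. *)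
Lemma group_ring_eq0 (A : 'M[K]_#|G|) : (A \in group_ring K G)%MS ->
  (forall n (rG : mx_representation K G n), mx_irreducible rG -> gring_op rG A = 0) ->
  A = 0.
Proof.
move=> /envelop_mxP[a AE] A0; apply/eqP.
have p'G : pgroup [pchar K]^' G.
  by apply/pgroupP => p _ _; rewrite inE /= char0.
have := mx_reducible_semisimple (mxmodule1 (regular_repr K G)) (mx_Maschke_pchar _ p'G).
apply=> -[I W V simW defW _]; rewrite -[A]mul1mx.
apply/eqP/sub_kermxP; rewrite -defW; apply/sumsmx_subP => i _.
have [modW _ _] := simW i; apply/sub_kermxP.
(* On the rows of W i, right multiplication by A is the operator of A in the representation on W
   i. *)
have : val_submod (gring_op (submod_repr modW) A) = val_submod (1%:M : 'M_(\rank (W i))) *m A.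
  rewrite AE mulmx_sumr [X in val_submod X]linear_sum /= [LHS]linear_sum /=.
  apply: eq_bigr => x Gx; rewrite -scalemxAr [X in val_submod X]linearZ /=.
  rewrite gring_opG // [LHS]linearZ /= -(val_submodJ modW _ Gx).
  by rewrite mul1mx.
rewrite A0; last exact/submod_mx_irr.
rewrite linear0 => /esym h.
have /submxP[B ->] : (W i <= val_submod (1%:M : 'M_(\rank (W i))))%MS by rewrite val_submod1.
by rewrite -mulmxA h mulmx0.
Qed.

End IrreducibleCharacters.

(** * Galois conjugates of irreducible characters *)

Section PowerMaps.
Variables (F : fieldType) (K : closedFieldType) (iota : {rmorphism F -> K}).
Hypothesis char0 : [pchar K] =i pred0.

(** In characteristic zero X^N - 1 is separable, so it has N distinct roots in K. *)
Lemma closed_prim_root N : (0 < N)%N -> exists z : K, N.-primitive_root z.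
Proof.
move=> N0; have nzN := natr_neq0 char0 N0.
have [rs] := closed_field_poly_normal ('X^N - 1 : {poly K}).
rewrite (monicP _) ?monicXnsubC // scale1r => rsE.
have /hasP[z _ zP] : has N.-primitive_root rs; last by exists z.
have rsP z : z \in rs -> N.-unity_root z.
  by rewrite /root_of_unity rsE root_prod_XsubC.
apply: cyclic.has_prim_root => //.
- by apply/allP.
- by rewrite -separable_prod_XsubC -rsE separable_Xn_sub_1.
- have : size ('X^N - 1 : {poly K}) = N.+1 by rewrite size_XnsubC.
  by rewrite rsE size_prod_XsubC => -[->].
Qed.

(** The exponent k comes from the image of one primitive root and serves all N-th roots of unity. *)
Lemma Gal_root_of_unity s N : (0 < N)%N -> Gal iota s ->
  exists k, forall z, z ^+ N = 1 -> s z = z ^+ k.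
Proof.
move=> N0 Gs; have [s' sE] := Gal_rmorph Gs.
have [w wP] := closed_prim_root N0.
have [k wk] : exists k, s' w = w ^+ k.
  have h : s' w ^+ N = 1 by rewrite -rmorphXn (prim_expr_order wP) rmorph1.
  by have [i ->] := prim_rootP wP h; exists i.
exists k => z /(prim_rootP wP)[i ->].
by rewrite -sE rmorphXn wk -!exprM mulnC.
Qed.

(** The minimal polynomial of A divides X^N - 1, a product of distinct linear factors, so A is
    diagonalisable; d lists its eigenvalues. *)
Lemma finite_order_trace n (A : 'M[K]_n.+1) N : (0 < N)%N -> A ^+ N = 1 ->
  exists d : 'I_n.+1 -> K, (forall i, d i ^+ N = 1) /\
    forall k, \tr (A ^+ k) = \sum_i d i ^+ k.
Proof.
move=> N0 AN.
have : exists2 rs : seq K, uniq rs & mxminpoly A %| \prod_(x <- rs) ('X - x%:P).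
  have [w wP] := closed_prim_root N0.
  exists [seq w ^+ (nat_of_ord i) | i <- enum 'I_N].
    rewrite map_inj_in_uniq ?enum_uniq // => i j _ _ /eqP.
    by rewrite (eq_prim_root_expr wP) !modn_small ?ltn_ord // => /eqP/val_inj.
  rewrite big_map big_enum /=.
  have -> : \prod_(i in 'I_N) ('X - (w ^+ i)%:P) = 'X^N - 1.
    by rewrite -(factor_Xn_sub_1 wP) big_mkord.
  by apply: mxminpoly_min; rewrite rmorphB rmorph1 /= rmorphXn /= horner_mx_X AN subrr.
move/(diagonalizableP A) => [P uP /similar_diagPex[D /(similarP uP) PA]].
have PAk k : P *m A ^+ k = diag_mx (\row_i D 0 i ^+ k) *m P.
  elim: k => [|k IH].
    rewrite expr0 mulmx1 -[LHS]mul1mx; congr (_ *m _).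
    by apply/matrixP => i j; rewrite !mxE expr0.
  rewrite exprS -mulmxE mulmxA PA -mulmxA IH mulmxA mulmx_diag; congr (diag_mx _ *m _).
  by apply/rowP => i; rewrite !mxE exprS.
exists (D 0); split=> [i|k]; last first.
  rewrite -[A ^+ k](mulKmx uP) PAk mxtrace_mulC mulmxK // mxtrace_diag.
  by apply: eq_bigr => i _; rewrite mxE.
have := PAk N; rewrite AN mulmx1 -[LHS]mul1mx => /(congr1 (mulmxr (invmx P))) /=.
rewrite !mulmxK // => /matrixP/(_ i i); rewrite !mxE eqxx !mulr1n.
by move=> <-.
Qed.

Variables (gT : finGroupType) (G : {group gT}).

(** chi(g) is a sum of |G|-th roots of unity, on which s is z |-> z^k. Hence s(chi(g)) = chi(g^k),
    and h is the k-th power map. *)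
Lemma irr_char_Gal_stable (chi : gT -> K) s : irr_char G chi -> Gal iota s ->
  exists h : gT -> gT, forall g, g \in G -> h g \in G /\ s (chi g) = chi (h g).
Proof.
move=> [n [rG [irrG chiE]]] Gs; have [s' sE] := Gal_rmorph Gs.
have [k kP] := Gal_root_of_unity (cardG_gt0 G) Gs.
exists (fun g => g ^+ k)%g => g Gg; split; first exact: groupX.
have n0 := irr_degree_gt0 irrG; rewrite !chiE ?groupX //.
case: n n0 rG irrG chiE => // n _ rG irrG chiE.
have [|d [dN dtr]] := finite_order_trace (cardG_gt0 G) (A := rG g).
  by rewrite -repr_mxX // cyclic.expg_cardG // repr_mx1.
have := dtr 1%N; rewrite expr1 => ->; rewrite repr_mxX // dtr -sE rmorph_sum.
by apply: eq_bigr => i _; rewrite sE expr1 kP.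
Qed.

(** Apply s to the matrix entries. Over a closed field irreducibility is absolute irreducibility,
    which survives a change of field. *)
Lemma irr_char_Gal (chi : gT -> K) s : irr_char G chi -> Gal iota s ->
  irr_char G (s \o chi).
Proof.
move=> [n [rG [irrG chiE]]] Gs; have [s' sE] := Gal_rmorph Gs.
exists n, (map_repr s' rG); split; last first.
  by move=> g Gg; rewrite /= chiE // -sE map_reprE trace_map_mx.
have a_irr := group_closure_closed_field irrG.
by apply: mx_abs_irrW; rewrite map_mx_abs_irr.
Qed.

End PowerMaps.

(** * Integral closure, Dedekind's Prague theorem and contents of polynomials *)

Section SubringType.
Variables (F : fieldType) (o : {pred F}) (Ho : subring_closed o).

(** The closure proof is an argument so that an algebraic instance can be attached to the
    predicate. *)
Definition subring_pred (_ : subring_closed o) : {pred F} := o.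

HB.instance Definition _ :=
  GRing.isSubringClosed.Build F (subring_pred Ho) Ho.

Record subring_type := SubringType {
  subring_val :> F; _ : subring_val \in subring_pred Ho }.

HB.instance Definition _ := [isSub for subring_val].
HB.instance Definition _ := [Choice of subring_type by <:].
HB.instance Definition _ := [SubChoice_isSubComNzRing of subring_type by <:].

Definition subring_emb : {rmorphism subring_type -> F} := \val.

Lemma subring_embP x : subring_emb x \in o.
Proof. exact: (valP x). Qed.

Lemma subring_emb_onto x : x \in o -> exists y, subring_emb y = x.
Proof. by move=> ox; exists (@SubringType x ox). Qed.

End SubringType.

Section IntegralClosure.
Variables (F : fieldType) (o : {pred F}) (Ho : subring_closed o).

Lemma polyOver_subringP (p : {poly F}) :
  reflect (forall i, p`_i \in o) (p \is a polyOver o).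
Proof. exact: (@polyOverP _ (subring_pred Ho) p). Qed.

Section Ring.
Variables (E : fieldType) (f : {rmorphism F -> E}).
Local Notation int := (int_closure f o).

(** This gives access to the closure properties of [integralOver], which wants a ring type as its
    base. *)
Lemma int_closureP x : int x <-> integralOver (f \o subring_emb Ho) x.
Proof.
split=> [[p [mp /polyOver_subringP op px]]|[p mp px]].
  have [c cE] := choice (fun i => subring_emb_onto Ho (op i)).
  have pE : p = map_poly (subring_emb Ho) (\poly_(i < size p) c i).
    apply/polyP => i; rewrite coef_map coef_poly; case: ltnP => [_|h].
      exact: esym (cE i).
    by rewrite nth_default //; apply/esym/rmorph0.
  move: pE; set q := \poly_(i < _) _ => pE.
  exists q; last by rewrite map_poly_comp -pE.
  have := monicP mp; rewrite pE lead_coef_map_inj; [|exact: val_inj|exact: rmorph0].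
  by rewrite -(rmorph1 (subring_emb Ho)) => /val_inj l1; apply/eqP.
exists (map_poly (subring_emb Ho) p); split.
- exact: monic_map.
- by apply/polyOver_subringP => i; rewrite coef_map; apply: subring_embP.
- by rewrite -map_poly_comp.
Qed.

Lemma int_closure0 : int 0. Proof. exact/int_closureP/integral0. Qed.
Lemma int_closure1 : int 1. Proof. exact/int_closureP/integral1. Qed.

Lemma int_closureD x y : int x -> int y -> int (x + y).
Proof. by move=> /int_closureP ix /int_closureP iy; apply/int_closureP/integral_add. Qed.

Lemma int_closureB x y : int x -> int y -> int (x - y).
Proof. by move=> /int_closureP ix /int_closureP iy; apply/int_closureP/integral_sub. Qed.

Lemma int_closureM x y : int x -> int y -> int (x * y).
Proof. by move=> /int_closureP ix /int_closureP iy; apply/int_closureP/integral_mul. Qed.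

Lemma int_closureX x n : int x -> int (x ^+ n).
Proof.
move=> ix; elim: n => [|n IH]; first by rewrite expr0; apply: int_closure1.
by rewrite exprS; apply: int_closureM.
Qed.

Lemma int_closure_sum I (r : seq I) (P : pred I) (h : I -> E) :
  (forall i, P i -> int (h i)) -> int (\sum_(i <- r | P i) h i).
Proof. by move=> ih; apply: big_ind => //; [apply: int_closure0 | apply: int_closureD]. Qed.

Lemma int_closure_in a : a \in o -> int (f a).
Proof.
by move=> /(subring_emb_onto Ho)[b <-]; apply/int_closureP; apply: (integral_id (f \o subring_emb Ho)).
Qed.

Lemma int_closure_root_monic p x : p \is monic -> (forall i, int p`_i) -> root p x -> int x.
Proof.
move=> mp ip px; apply/int_closureP; apply: (integral_root_monic mp px) => _ /(nthP 0)[i _ <-].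
exact/int_closureP.
Qed.

(** Induction on the degree m of q. Its leading coefficient c is also that of the product, and c r
    is integral, so q - c X^m satisfies the same hypothesis. *)
Lemma int_closure_div_root (q : {poly E}) r :
  (forall i, int (q * ('X - r%:P))`_i) -> forall i, int q`_i.
Proof.
have [n] := ubnP (size q); elim: n q => // n IH q; rewrite ltnS => sq iq.
have [->|nzq] := eqVneq q 0; first by move=> i; rewrite coef0; apply: int_closure0.
pose f' := q * ('X - r%:P); pose c := lead_coef q.
have szq : size q = (size q).-1.+1 by rewrite prednK // size_poly_gt0.
set m := (size q).-1 in szq.
have sf' : size f' = m.+2.
  by rewrite /f' size_Mmonic ?monicXsubC // size_XsubC addn2 szq.
have lf' : f'`_m.+1 = c.
  have : lead_coef f' = c by rewrite lead_coef_Mmonic ?monicXsubC.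
  by rewrite lead_coefE sf'.
have ic : int c by rewrite -lf'; apply: iq.
have f'r : \sum_(i < m.+2) f'`_i * r ^+ i = 0.
  by rewrite -[m.+2]sf' -horner_coef /f' hornerM hornerXsubC subrr mulr0.
(* c * r is a root of the monic polynomial c ^ m * f'(X / c). *)
have icr : int (c * r).
  pose p : {poly E} := 'X^(m.+1) + \poly_(i < m.+1) (f'`_i * c ^+ (m - i)).
  apply: (@int_closure_root_monic p).
  - by rewrite monicE lead_coefDl ?lead_coefXn // size_polyXn ltnS size_poly.
  - move=> i; rewrite coefD coefXn coef_poly; apply: int_closureD.
      by case: eqP => _; [apply: int_closure1 | apply: int_closure0].
    by case: ifP => _; [apply: int_closureM; [apply: iq | apply: int_closureX] | apply: int_closure0].
  - rewrite rootE /p hornerD hornerXn horner_poly.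
    apply/eqP; transitivity (c ^+ m * \sum_(i < m.+2) f'`_i * r ^+ i).
      rewrite [X in _ = _ * X]big_ord_recr /= lf' mulrDr addrC mulr_sumr.
      congr (_ + _); last by rewrite mulrA -exprSr exprMn.
      apply: eq_bigr => i _; rewrite exprMn [RHS]mulrCA -mulrA; congr (_ * _).
      by rewrite mulrA -exprD subnK // -ltnS.
    by rewrite f'r mulr0.
pose q' : {poly E} := q - c *: 'X^m.
have sq' : (size q' < n)%N.
  apply: leq_trans sq; rewrite szq ltnS; apply/leq_sizeP => j.
  rewrite leq_eqVlt coefB coefZ coefXn => /orP[/eqP <-|lt].
    by rewrite eqxx mulr1 /c lead_coefE subrr.
  by rewrite nth_default ?szq // gtn_eqF // mulr0 subr0.
have iq' := IH q' sq'.
move=> i; have -> : q`_i = q'`_i + c * (i == m)%:R.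
  by rewrite coefB coefZ coefXn subrK.
apply: int_closureD; last by apply: int_closureM => //; case: eqP => _; [apply: int_closure1 | apply: int_closure0].
apply: iq' => j.
have -> : q' * ('X - r%:P) = f' - c *: 'X^(m.+1) + (c * r) *: 'X^m.
  by rewrite /q' /f' -!mul_polyC polyCM exprS; ring.
rewrite coefD coefB !coefZ !coefXn; apply: int_closureD; first apply: int_closureB; first exact: iq.
  by apply: int_closureM => //; case: eqP => _; [apply: int_closure1 | apply: int_closure0].
by apply: int_closureM => //; case: eqP => _; [apply: int_closure1 | apply: int_closure0].
Qed.

(** Induction on R. Removing the root r leaves an integral polynomial q, and r q = q X - q (X - r)
    is integral too; so the induction hypothesis applies with the constants c and r c, which
    together give the coefficients for r :: R. *)
Lemma int_closure_split_coef_mul (R T : seq E) c :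
  (forall i, int (c *: \prod_(x <- R ++ T) ('X - x%:P))`_i) -> forall i j,
  int (c * (\prod_(x <- R) ('X - x%:P))`_i * (\prod_(x <- T) ('X - x%:P))`_j).
Proof.
elim: R c => [|r R IH] c /= ic i j.
  rewrite big_nil coefC; case: ifP => _.
    by rewrite mulr1 -coefZ.
  by rewrite mulr0 mul0r; apply: int_closure0.
set q := c *: \prod_(x <- R ++ T) ('X - x%:P) in ic *.
have qE : c *: \prod_(x <- r :: (R ++ T)) ('X - x%:P) = q * ('X - r%:P).
  by rewrite big_cons -scalerAl mulrC.
have iq : forall l, int q`_l by apply: (int_closure_div_root (r := r)) => l; rewrite -qE.
have irq l : int (r * q`_l).
  have : int ((q * 'X)`_l - (q * ('X - r%:P))`_l).
    apply: int_closureB; last by rewrite -qE.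
    by rewrite coefMX; case: ifP => _; [apply: int_closure0 | apply: iq].
  by rewrite -coefB -mulrBr opprB addrCA subrr addr0 coefMC mulrC.
have h1 := IH c iq; have h2 := IH (r * c).
rewrite big_cons mulrBl coefB coefXM coefCM mulrBr mulrBl; apply: int_closureB.
  case: ifP => _; last exact: h1.
  by rewrite mulr0 mul0r; apply: int_closure0.
rewrite (mulrA c) (mulrC c); apply: h2 => l.
by rewrite -scalerA coefZ; apply: irq.
Qed.

End Ring.

(* Dedekind's Prague theorem. *)
Lemma int_closure_coef_mul (K : closedFieldType) (f : {rmorphism F -> K}) (p q : {poly K}) :
  (forall i, int_closure f o (p * q)`_i) -> forall i j, int_closure f o (p`_i * q`_j).
Proof.
have [R pE] := closed_field_poly_normal p.
have [T qE] := closed_field_poly_normal q.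
move=> ipq i j; have := @int_closure_split_coef_mul K f R T (lead_coef p * lead_coef q).
have pq : p * q = (lead_coef p * lead_coef q) *: \prod_(z <- R ++ T) ('X - z%:P).
  by rewrite {1}pE {1}qE big_cat /= -scalerAl -scalerAr scalerA.
move=> h; rewrite pE coefZ qE coefZ mulrACA mulrA; apply: h => l.
by rewrite -pq; apply: ipq.
Qed.

Lemma int_closure_emb (E K : fieldType) (f : {rmorphism F -> E}) (t : {rmorphism E -> K})
    (g : {rmorphism F -> K}) x : (forall a, t (f a) = g a) ->
  int_closure f o x <-> int_closure g o (t x).
Proof.
move=> tf; have mE p : map_poly g p = map_poly t (map_poly f p).
  by rewrite -map_poly_comp; apply: eq_map_poly => a /=.
split=> -[p [mp op px]]; exists p; split=> //.
  by rewrite mE rootE horner_map (rootP px) rmorph0.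
by move: px; rewrite mE !rootE horner_map fmorph_eq0.
Qed.

Hypothesis Hval : forall x, x != 0 -> x \in o \/ x^-1 \in o.

(** The coefficient at m has least valuation and serves as the content of p. It is found by
    comparing the coefficients one after the other with [Hval]. *)
Lemma content_exists (p : {poly F}) : p != 0 ->
  exists m, p`_m != 0 /\ forall i, p`_i / p`_m \in o.
Proof.
pose o' := subring_pred Ho; move=> nzp.
have key n : (exists2 i, (i < n)%N & p`_i != 0) -> exists m, p`_m != 0 /\ forall i, (i < n)%N -> p`_i / p`_m \in o.
  elim: n => [[]//|n IH] [i lin nzi].
  case: (pselect (exists2 i, (i < n)%N & p`_i != 0)) => [/IH[m [nzm mP]]|none].
    have [n0|nzn] := eqVneq p`_n 0.
      exists m; split=> // j; rewrite ltnS leq_eqVlt => /orP[/eqP ->|]; last exact: mP.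
      by rewrite n0 mul0r; apply: (rpred0 o').
    have nzr : p`_n / p`_m != 0 by rewrite mulf_neq0 ?invr_eq0.
    have [h|h] := Hval nzr.
      by exists m; split=> // j; rewrite ltnS leq_eqVlt => /orP[/eqP ->|]; last exact: mP.
    exists n; split=> // j; rewrite ltnS leq_eqVlt => /orP[/eqP ->|/mP oj].
      by rewrite divff //; apply: (rpred1 o').
    have -> : p`_j / p`_n = p`_j / p`_m * (p`_n / p`_m)^-1.
      by rewrite invf_div mulrA mulfVK.
    exact: (rpredM (s := o')).
  have z j : (j < n)%N -> p`_j = 0.
    by move=> jn; apply/eqP; apply: contrapT => /negP nz; apply: none; exists j.
  have ein : i = n.
    move: lin; rewrite ltnS leq_eqVlt => /orP[/eqP //|/z h].
    by rewrite h eqxx in nzi.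
  exists n; rewrite -{1}ein; split=> // j; rewrite ltnS leq_eqVlt => /orP[/eqP ->|/z ->].
    by rewrite divff -?ein //; apply: (rpred1 o').
  by rewrite mul0r; apply: (rpred0 o').
have [|m [nzm mP]] := key (size p).
  exists (size p).-1; first by rewrite prednK // size_poly_gt0.
  by rewrite -lead_coefE lead_coef_eq0.
exists m; split=> // i; have [/mP //|h] := ltnP i (size p).
by rewrite nth_default // mul0r; apply: (rpred0 o').
Qed.

End IntegralClosure.

(** * The ring of integers as a valuation ring *)

Section ValuationRing.
Variables (F : fieldType) (v : F -> int) (HF : local_field v).

Lemma val1 : v 1 = 0.
Proof.
have := val_mul HF (oner_neq0 F) (oner_neq0 F); rewrite mulr1 => /eqP.
by rewrite -{1}[v 1]addr0 (inj_eq (addrI _)) => /eqP.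
Qed.

Lemma valN1 : v (-1) = 0.
Proof.
have nz : (-1 : F) != 0 by rewrite oppr_eq0 oner_neq0.
have := val_mul HF nz nz; rewrite mulrNN mulr1 val1 -mulr2n => /esym/eqP.
by rewrite mulrn_eq0 => /eqP.
Qed.

Lemma val_ring_subring : subring_closed (val_ring v).
Proof.
split.
- by rewrite inE /= val1 lexx orbT.
- move=> x y; rewrite !inE /=.
  have [->|nzx] /= := eqVneq x 0; have [->|nzy] /= := eqVneq y 0; rewrite ?subr0 ?eqxx //.
  + move=> _ vy; rewrite sub0r oppr_eq0 (negPf nzy) /= -mulN1r.
    by rewrite (val_mul HF) ?oppr_eq0 ?oner_neq0 // valN1 add0r.
  + by move=> -> _; rewrite orbT.
  + move=> vx vy; have [//|nz] /= := eqVneq (x - y) 0.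
    have vNy : v (- y) = v y.
      by rewrite -mulN1r (val_mul HF) ?oppr_eq0 ?oner_neq0 // valN1 add0r.
    have := @val_add _ _ HF x (- y) nzx; rewrite oppr_eq0 => /(_ nzy nz).
    by apply: le_trans; rewrite le_min vx vNy.
- move=> x y; rewrite !inE /=.
  have [->|nzx] /= := eqVneq x 0; first by rewrite mul0r eqxx.
  have [->|nzy] /= := eqVneq y 0; first by rewrite mulr0 eqxx.
  by move=> vx vy; rewrite (val_mul HF) // addr_ge0 // orbT.
Qed.

Lemma val_ring_inv x : x != 0 -> x \in val_ring v \/ x^-1 \in val_ring v.
Proof.
move=> nzx; rewrite !inE /= invr_eq0 (negPf nzx) /=.
have := val_mul HF nzx (_ : x^-1 != 0); rewrite invr_eq0 divff // val1 => /(_ nzx) /esym/eqP.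
rewrite addr_eq0 => /eqP ->; rewrite oppr_ge0; apply/orP; exact: le_total.
Qed.

End ValuationRing.

(** * Invertibility of the ideal A and a trace criterion for the conductor summand *)

Section ConductorSummand.
Variables (F : fieldType) (K : closedFieldType) (iota : {rmorphism F -> K}).
Hypotheses (Halg : is_alg_closure iota) (char0 : [pchar F] =i pred0).
Variables (gT : finGroupType) (G : {group gT}) (chi : gT -> K).
Hypothesis irr_chi : irr_char G chi.
Variables (o : {pred F}) (Ho : subring_closed o).
Hypothesis Hval : forall x, x != 0 -> x \in o \/ x^-1 \in o.

Local Notation S := [set chi g | g in [set` G]].
Local Notation E := (adjoin iota S).
Local Notation emb := (adjoin_emb iota S).
Local Notation f := (@in_adjoin F K iota S).
Local Notation cv := (char_val iota G chi : gT -> E).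
Local Notation O := (int_closure f o).

Lemma pchar_closure : [pchar K] =i pred0.
Proof. by move=> p; rewrite (fmorph_pchar iota) char0. Qed.

Let stable := fun s => @irr_char_Gal_stable F K iota pchar_closure gT G chi s irr_chi.

Lemma pchar_char_field : [pchar E] =i pred0.
Proof. by move=> p; rewrite (fmorph_pchar (in_adjoin iota S)) char0. Qed.

Lemma char_val1_neq0 : cv 1%g != 0.
Proof.
have [n [rG [irrG chiE]]] := irr_chi.
rewrite -(fmorph_eq0 emb) (emb_char_val iota chi (group1 G)) chiE // repr_mx1 mxtrace1.
by rewrite ((pcharf0P K).1 pchar_closure) -lt0n (irr_degree_gt0 irrG).
Qed.

Lemma card_char_field_neq0 : #|G|%:R != 0 :> E.
Proof. by rewrite ((pcharf0P E).1 pchar_char_field) -lt0n cardG_gt0. Qed.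

Lemma Gal_seq_id : id \in Gal_seq f.
Proof. exact/(mem_Gal_seq Halg stable)/Gal_id. Qed.

(** The b g lie in the inverse of A and exhibit 1 as an element of A^-1 A; they are coefficients of
    the cofactor of P in its norm, divided by the content. *)
Lemma char_ideal_invertible : exists b : gT -> E,
  (forall g h, h \in G -> O (b g * cv h)) /\ \sum_(g in G) b g * cv g = 1.
Proof.
(* Distinct exponents keep the values of chi apart as coefficients. *)
pose P := \sum_(g in G) cv g *: 'X^(enum_rank g) : {poly E}.
have PE h : h \in G -> P`_(enum_rank h) = cv h.
  move=> Gh; rewrite coef_sum (bigD1 h) //= coefZ coefXn eqxx mulr1 big1 ?addr0 // => g /andP[_ gh].
  rewrite coefZ coefXn; case: eqP => [e|]; last by rewrite mulr0.
  by move: gh; rewrite -(inj_eq enum_rank_inj) -val_eqE /= e eqxx.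
pose N := \prod_(s <- Gal_seq f) map_poly s P.
have map0 s : Gal f s -> s 0 = 0.
  by move=> /(Gal_rmorph (f := in_adjoin iota S))[s' sE]; rewrite -sE rmorph0.
have Nfix t : Gal f t -> forall i, t N`_i = N`_i.
  move=> Gt i; have [t' tE] := Gal_rmorph (f := in_adjoin iota S) Gt.
  rewrite -tE -coef_map /N rmorph_prod /=; congr ((polyseq _)`_i).
  rewrite -[RHS](perm_big _ (Gal_seq_comp Halg stable Gt)) big_map big_seq [RHS]big_seq.
  apply: eq_bigr => s /(mem_Gal_seq Halg stable) Gs; apply/polyP => j.
  rewrite coef_map !coef_map_id0 ?map0 //=; last exact: (Gal_comp (f := in_adjoin iota S)).
have [a aE] := choice (fun i => Gal_char_field_fixed Halg char0 stable (fun t Gt => Nfix t Gt i)).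
pose N0 := \poly_(i < size N) a i.
have NE i : N`_i = f N0`_i.
  rewrite coef_poly; case: ltnP => [_|le]; first exact: aE.
  by rewrite nth_default //; exact: esym (rmorph0 (in_adjoin iota S)).
pose h := \prod_(s <- rem (id : E -> E) (Gal_seq f)) map_poly s P.
have NPh : N = P * h by rewrite /N (big_rem _ Gal_seq_id) /= map_poly_id.
have nzN0 : N0 != 0.
  have : N != 0.
    rewrite prodf_seq_neq0; apply/allP => s /(mem_Gal_seq Halg stable) Gs /=.
    apply/eqP => /polyP/(_ (enum_rank (1%g : gT))); rewrite coef0 coef_map_id0 ?map0 // PE //.
    have [s' sE] := Gal_rmorph (f := in_adjoin iota S) Gs; rewrite -sE => /eqP.
    by rewrite fmorph_eq0 (negPf char_val1_neq0).
  apply: contraNneq => z; apply/eqP/polyP => i; rewrite NE z !coef0.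
  exact: rmorph0 (in_adjoin iota S).
have [m [nzm mP]] := content_exists Ho Hval nzN0.
pose h' := (f N0`_m)^-1 *: h.
have nzfm : f N0`_m != 0 by rewrite (fmorph_eq0 (in_adjoin iota S)).
have Ph' i : (P * h')`_i = f (N0`_i / N0`_m).
  rewrite -scalerAr -NPh coefZ NE mulrC; apply/esym; exact: fmorph_div (in_adjoin iota S) _ _.
(* P h' has integral coefficients by the choice of m; the Prague theorem is applied in K, where both
   factors split. *)
have iPh' i j : O (P`_i * h'`_j).
  apply/(int_closure_emb o _ (t := emb) (g := iota)) => //.
  rewrite rmorphM -!(coef_map emb); apply: int_closure_coef_mul => // l.
  have -> : map_poly emb P * map_poly emb h' = map_poly emb (P * h') by rewrite rmorphM.
  by rewrite coef_map Ph'; apply: int_closure_in (mP l).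
(* b g is the coefficient of h' at m - rank g, or 0 if rank g exceeds m, so the sum of the b g
   chi(g) is the m-th coefficient of P h', which is 1. *)
exists (fun g => ('X^(enum_rank g) * h')`_m); split.
  move=> g g' Gg'; rewrite coefXnM -PE //; case: ifP => _.
    by rewrite mul0r; apply: int_closure0.
  by rewrite mulrC.
have <- : (P * h')`_m = 1.
  rewrite Ph' divff //; exact: rmorph1 (in_adjoin iota S).
rewrite mulr_suml coef_sum; apply: eq_bigr => g Gg.
by rewrite -scalerAl coefZ mulrC.
Qed.

Lemma inv_different_sum I (r : seq I) (Q : pred I) (x : I -> E) :
  (forall i, Q i -> inv_different f o (x i)) -> inv_different f o (\sum_(i <- r | Q i) x i).
Proof.
move=> Dx; apply: big_ind => //.
  move=> y _; exists 0; first exact: (rpred0 (subring_pred Ho)).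
  have := Tr_char_fieldD Halg stable 0 0; rewrite mul0r addr0 => /eqP.
  rewrite -{1}[Tr _ _]addr0 (inj_eq (addrI _)) => /eqP <-.
  exact: esym (rmorph0 (in_adjoin iota S)).
move=> x1 x2 D1 D2 y Oy; have [a1 o1 e1] := D1 y Oy; have [a2 o2 e2] := D2 y Oy.
exists (a1 + a2); first exact: (rpredD (S := subring_pred Ho)).
rewrite mulrDl (Tr_char_fieldD Halg stable) e1 e2.
exact: esym (rmorphD (in_adjoin iota S) _ _).
Qed.

Lemma inv_differentM (c x : E) : O c -> inv_different f o x -> inv_different f o (c * x).
Proof.
by move=> Oc Dx y Oy; rewrite (mulrC c) -mulrA; apply: Dx; apply: int_closureM.
Qed.

(** Up to the scalar |G| / chi(1), membership in A^-1 D^-1 means that multiplication maps A into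
    D^-1, because A is invertible. *)
Lemma conductor_summandP (x : E) : conductor_summand iota G o chi x <->
  forall g, g \in G -> inv_different f o (x * (cv 1%g / #|G|%:R) * cv g).
Proof.
have nz1 := char_val1_neq0; have nzG := card_char_field_neq0; split.
  move=> [y [n [c [d [Ac Dd yE]]]] <-] g Gg.
  have -> : #|G|%:R / cv 1%g * y * (cv 1%g / #|G|%:R) * cv g = cv g * y.
    by field; rewrite nz1 nzG.
  rewrite yE mulr_sumr; apply: inv_different_sum => i _.
  rewrite mulrA; apply: inv_differentM; last exact: Dd.
  rewrite mulrC; apply: Ac; exists 1%N, (fun=> 1), (fun=> cv g); split.
  - by move=> _; apply: int_closure1.
  - by move=> _; exists g.
  - by rewrite big_ord1 [RHS]mul1r.
(* Multiplying by 1 = sum of the b g chi(g) writes the element as a sum of products from A^-1 and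
   D^-1. *)
move=> Dx; have [b [bO b1]] := char_ideal_invertible.
exists (x * (cv 1%g / #|G|%:R)); last by field; rewrite nz1 nzG.
exists #|G|, (fun i => b (enum_val i)), (fun i => x * (cv 1%g / #|G|%:R) * cv (enum_val i)); split.
- move=> i _ [n [c [d [Oc vd ->]]]]; rewrite mulr_sumr; apply: int_closure_sum => // j _.
  have [g Gg <-] := vd j; have -> : b (enum_val i) * (c j *: (cv g : E^o)) = c j * (b (enum_val i) * cv g).
    exact: mulrCA.
  by apply: int_closureM => //; [exact: Oc | exact: bO].
- by move=> i; apply: Dx; apply: enum_valP.
- rewrite -[LHS]mulr1 -b1 mulr_sumr big_enum_val; apply: eq_bigr => i _.
  by rewrite [RHS]mulrCA.
Qed.

End ConductorSummand.

(** * Central elements of the group ring and their components at the characters *)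

Lemma map_mx_regular_repr (F K : fieldType) (iota : {rmorphism F -> K})
    (gT : finGroupType) (G : {group gT}) g :
  map_mx iota (regular_repr F G g) = regular_repr K G g.
Proof. exact: map_regular_repr. Qed.

Lemma map_mx_group_sum (F K : fieldType) (iota : {rmorphism F -> K})
    (gT : finGroupType) (G : {group gT}) (a : gT -> F) :
  map_mx iota (\sum_(g in G) a g *: regular_repr F G g) =
  \sum_(g in G) iota (a g) *: regular_repr K G g.
Proof.
rewrite (big_morph _ (@map_mxD _ _ iota _ _) (map_mx0 iota _ _)).
by apply: eq_bigr => g Gg; rewrite map_mxZ map_mx_regular_repr.
Qed.

Section CentreEmbed.
Variables (F : fieldType) (K : closedFieldType) (iota : {rmorphism F -> K}).
Hypotheses (Halg : is_alg_closure iota) (char0 : [pchar F] =i pred0).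
Variables (gT : finGroupType) (G : {group gT}).

Let char0K : [pchar K] =i pred0 := pchar_closure iota char0.

Section OneCharacter.
Variable chi : gT -> K.
Hypothesis irr_chi : irr_char G chi.

Local Notation S := [set chi g | g in [set` G]].
Local Notation E := (adjoin iota S).
Local Notation emb := (adjoin_emb iota S).
Local Notation f := (@in_adjoin F K iota S).
Local Notation cv := (char_val iota G chi : gT -> E).

Let stable := fun s => @irr_char_Gal_stable F K iota char0K gT G chi s irr_chi.

Lemma char_val1 : exists2 n, chi 1%g = n%:R & cv 1%g = n%:R.
Proof.
have [n [rG [irrG chiE]]] := irr_chi; exists n.
  by rewrite chiE // repr_mx1 mxtrace1.
apply: adjoin_emb_inj; rewrite (emb_char_val iota chi (group1 G)) chiE // repr_mx1 mxtrace1.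
by rewrite rmorph_nat.
Qed.

(** Exchanging the sums over G and over the Galois group turns each coefficient into a trace, so the
    element is defined over F. *)
Lemma centre_embed_coef (alpha : E) : exists a : gT -> F,
  (forall g, Tr f (alpha * (cv 1%g / #|G|%:R) * cv g^-1%g) = f (a g)) /\
  centre_embed alpha = map_mx iota (\sum_(g in G) a g *: regular_repr F G g).
Proof.
have [a aE] := choice (fun g => Tr_char_field_base Halg char0 stable (alpha * (cv 1%g / #|G|%:R) * cv g^-1%g)).
exists a; split=> //.
rewrite /centre_embed (sum_GalE Halg stable).
under eq_bigr do rewrite scaler_sumr.
rewrite exchange_big map_mx_group_sum; apply: eq_bigr => g Gg.
rewrite -(adjoin_emb_base iota S) -aE (Tr_char_fieldE Halg stable).
rewrite rmorph_sum scaler_suml big_seq [RHS]big_seq; apply: eq_bigr => s /(mem_Gal_seq Halg stable) Gs.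
rewrite scalerA; congr (_ *: _); have [s' sE] := Gal_rmorph (f := in_adjoin iota S) Gs.
rewrite !adjoin_embE -!sE.
(* chi(1) is a natural number, hence fixed by s, and may be moved under s. *)
have [n -> cvn] := char_val1; rewrite cvn.
by rewrite !(rmorphM, fmorphV, rmorph_nat).
Qed.

(** By orthogonality only an s with s(chi) equal to the character of rG contributes, and there is at
    most one such s. *)
Lemma gring_op_centre_embed (alpha : E) n (rG : mx_representation K G n) :
  mx_irreducible rG ->
  (forall t, Gal f t -> {in G, forall g, emb (t (cv g)) = \tr (rG g)} ->
     gring_op rG (centre_embed alpha) = (emb (t alpha))%:M) /\
  ((forall t, Gal f t -> ~ {in G, forall g, emb (t (cv g)) = \tr (rG g)}) ->
     gring_op rG (centre_embed alpha) = 0).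
Proof.
move=> irrG.
have nzn : n%:R != 0 :> K by rewrite ((pcharf0P K).1 char0K) -lt0n (irr_degree_gt0 irrG).
have nzG : #|G|%:R != 0 :> K by rewrite ((pcharf0P K).1 char0K) -lt0n cardG_gt0.
have opE : gring_op rG (centre_embed alpha) =
    \sum_(s <- Gal_seq f) if `[< {in G, forall g, emb (s (cv g)) = \tr (rG g)} >]
      then (emb (s alpha))%:M else 0.
  rewrite /centre_embed (sum_GalE Halg stable) linear_sum big_seq [RHS]big_seq.
  apply: eq_bigr => s /(mem_Gal_seq Halg stable) Gs; rewrite [LHS]linearZ /= linear_sum /=.
  under eq_bigr => g Gg do rewrite [gring_op _ _]linearZ /= gring_opG //.
  have [t Gt tE] := Gal_char_field_ext Halg Gs.
  have irr_s : irr_char G (fun g => emb (s (cv g))).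
    have [m [rH [irrH chiE]]] := irr_char_Gal irr_chi Gt.
    exists m, rH; split=> // g Gg; rewrite -(chiE g Gg) -tE.
    by rewrite (emb_char_val iota chi Gg).
  have := irr_char_sum char0K irr_s irrG => /= ->.
  case: asboolP => [h|_]; last by rewrite scaler0.
  rewrite scale_scalar_mx; congr (_%:M); rewrite adjoin_embE.
  have [m -> cvm] := char_val1.
  have : emb (s (cv 1%g)) = \tr (rG 1%g) := h 1%g (group1 G).
  rewrite repr_mx1 mxtrace1 cvm -tE rmorph_nat.
  have [t' t'E] := Gal_rmorph Gt; rewrite -t'E rmorph_nat => ->.
  by rewrite -mulrA [X in _ * X](_ : _ = 1) ?mulr1 //; field; rewrite nzn nzG.
split=> [t Gt tG|none]; rewrite opE.
  have tL : t \in Gal_seq f by apply/(mem_Gal_seq Halg stable).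
  rewrite (big_rem t) //=; case: asboolP => // _; rewrite big_seq big1 ?addr0 // => s.
  rewrite mem_rem_uniq ?Gal_seq_uniq // inE => /andP[/eqP st /(mem_Gal_seq Halg stable) Gs].
  case: asboolP => // sG; case: st; apply: (Gal_char_field_inj (G := G) Gs Gt) => g Gg.
  by apply: adjoin_emb_inj; rewrite (tG g Gg); apply: sG.
rewrite big_seq big1 // => s /(mem_Gal_seq Halg stable) Gs.
by case: asboolP => // h; case: (none s Gs).
Qed.

End OneCharacter.

Section Representatives.
Variables (k : nat) (chi : 'I_k -> gT -> K).
Hypothesis Hchi : irr_representatives iota G chi.

Local Notation S i := [set chi i g | g in [set` G]].
Local Notation E i := (adjoin iota (S i)).
Local Notation emb i := (adjoin_emb iota (S i)).
Local Notation f i := (@in_adjoin F K iota (S i)).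
Local Notation cv i := (char_val iota G (chi i) : gT -> E i).

Let irr_chi i : irr_char G (chi i). Proof. by case: Hchi. Qed.
Let stable i := fun s => @irr_char_Gal_stable F K iota char0K gT G (chi i) s (irr_chi i).

(** rG affords the conjugate t(chi_i), so that the pairs (i, t) index the irreducible
    representations over K. *)
Definition labels n (rG : mx_representation K G n) i (t : E i -> E i) :=
  Gal (f i) t /\ {in G, forall g, emb i (t (cv i g)) = \tr (rG g)}.

Lemma label_exists n (rG : mx_representation K G n) : mx_irreducible rG ->
  exists i t, labels rG (i := i) t.
Proof.
move=> irrG; have [_ /(_ (fun g => \tr (rG g)))[]] := Hchi.
  by exists n, rG; split.
move=> i [s Gs sE] _; have [t Gt tE] := Gal_restr (@stable i) Gs.
by exists i, t; split=> // g Gg; rewrite tE (emb_char_val iota (chi i) Gg) sE.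
Qed.

(** Lifts of t and of the inverse of u to K compose to an automorphism that carries chi_i to
    chi_j. *)
Lemma label_unique n (rG : mx_representation K G n) i j (t : E i -> E i) (u : E j -> E j) :
  labels rG t -> labels rG u -> i = j.
Proof.
move=> [Gt tE] [Gu uE]; have [_ _ inj] := Hchi; apply: inj.
have [t1 Gt1 t1E] := Gal_char_field_ext Halg Gt.
have [u1 Gu1 u1E] := Gal_char_field_ext Halg Gu.
have [w [Gw uw wu]] := Gal_inv Gu1.
exists (w \o t1); first exact: Gal_comp.
move=> g Gg /=; rewrite -(emb_char_val iota (chi i) Gg) t1E tE // -uE // -u1E uw.
by rewrite (emb_char_val iota (chi j) Gg).
Qed.

Lemma label_id i : exists n (rG : mx_representation K G n),
  mx_irreducible rG /\ labels rG (i := i) id.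
Proof.
have [n [rG [irrG chiE]]] := irr_chi i; exists n, rG; split=> //; split.
  exact: (Gal_id (in_adjoin iota (S i))).
by move=> g Gg; rewrite (emb_char_val iota (chi i) Gg) chiE.
Qed.

(** A is the central element with components alpha, expressed through its scalar action on all
    irreducible representations. In this form ring operations are componentwise. *)
Definition acts_by (A : 'M[K]_#|G|) (alpha : forall i, E i) :=
  (A \in group_ring K G)%MS /\
  forall n (rG : mx_representation K G n), mx_irreducible rG ->
  forall i (t : E i -> E i), labels rG t -> gring_op rG A = (emb i (t (alpha i)))%:M.

Lemma acts_by_inj A B alpha : acts_by A alpha -> acts_by B alpha -> A = B.
Proof.
move=> [RA aA] [RB aB]; apply/eqP; rewrite -subr_eq0; apply/eqP.
apply: (group_ring_eq0 char0K) => [|n rG irrG].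
  by rewrite linearB /= addmx_sub // eqmx_opp.
have [i [t lt]] := label_exists irrG.
by rewrite [LHS]linearB /= (aA _ _ irrG _ _ lt) (aB _ _ irrG _ _ lt) subrr.
Qed.

Lemma acts_byM A B alpha beta : acts_by A alpha -> acts_by B beta ->
  acts_by (A *m B) (fun i => alpha i * beta i).
Proof.
move=> [RA aA] [RB aB]; split; first exact: envelop_mxM.
move=> n rG irrG i t lt; rewrite gring_opM // (aA _ _ irrG _ _ lt) (aB _ _ irrG _ _ lt).
rewrite -scalar_mxM; congr (_%:M); have [Gt _] := lt.
have [t' tE] := Gal_rmorph (f := in_adjoin iota (S i)) Gt.
by rewrite -!tE !rmorphM.
Qed.

Lemma acts_by_sum I (r : seq I) (A : I -> 'M[K]_#|G|) (alpha : I -> forall i, E i) :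
  (forall l, acts_by (A l) (alpha l)) ->
  acts_by (\sum_(l <- r) A l) (fun i => \sum_(l <- r) alpha l i).
Proof.
move=> aA; split; first by rewrite linear_sum summx_sub // => l _; case: (aA l).
move=> n rG irrG i t lt.
have [t' tE] := Gal_rmorph (f := in_adjoin iota (S i)) lt.1.
rewrite linear_sum -tE !rmorph_sum; apply: eq_bigr => l _.
by case: (aA l) => _ /(_ _ _ irrG _ _ lt) h; rewrite [LHS]h -tE.
Qed.

Lemma acts_byZ c A alpha : acts_by A alpha ->
  acts_by (iota c *: A) (fun i => f i c * alpha i).
Proof.
move=> [RA aA]; split; first by rewrite linearZ scalemx_sub.
move=> n rG irrG i t lt; rewrite [LHS]linearZ /= (aA _ _ irrG _ _ lt) scale_scalar_mx.
congr (_%:M); have [t' tE] := Gal_rmorph (f := in_adjoin iota (S i)) lt.1.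
rewrite -!tE !rmorphM; congr (_ * _); rewrite tE.
by case: lt => -[_ _ _ ->].
Qed.

Lemma acts_by1 : acts_by 1%:M (fun=> 1).
Proof.
split; first by rewrite -(repr_mx1 (regular_repr K G)) envelop_mx_id.
move=> n rG irrG i t lt; rewrite gring_op1; congr (_%:M).
have [t' tE] := Gal_rmorph (f := in_adjoin iota (S i)) lt.1.
by rewrite -tE !rmorph1.
Qed.

Lemma map_group_ring (x : 'M[F]_#|G|) : (x \in group_ring F G)%MS ->
  (map_mx iota x \in group_ring K G)%MS.
Proof.
move=> /envelop_mxP[a ->]; apply/envelop_mxP; exists (fun g => iota (a g)).
exact: map_mx_group_sum.
Qed.

(** On a representation with label (i, t) the summand of i gives t(alpha_i); the others vanish
    because i is unique. *)
Lemma acts_by_centre_embed (alpha : forall i, E i) :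
  acts_by (\sum_(i < k) centre_embed (alpha i)) alpha.
Proof.
split.
  rewrite linear_sum summx_sub // => i _.
  have [a [_ ->]] := centre_embed_coef (irr_chi i) (alpha i).
  by apply: map_group_ring; apply/envelop_mxP; exists a.
move=> n rG irrG i t lt; rewrite linear_sum (bigD1 i) //= big1 ?addr0 => [|j ji].
  have [h _] := gring_op_centre_embed (irr_chi i) (alpha i) irrG.
  by case: lt => Gt tE; apply: h.
have [_ h] := gring_op_centre_embed (irr_chi j) (alpha j) irrG.
apply: h => u Gu uE; move: ji; rewrite (label_unique lt (conj Gu uE)).
by rewrite eqxx.
Qed.

(* The central character of x at chi i is (sum_g a_g chi_i(g)) / chi_i(1). *)
Lemma centre_acts_by (x : 'M[F]_#|G|) : (x \in group_ring F G)%MS ->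
  (forall g, g \in G -> x *m regular_repr F G g = regular_repr F G g *m x) ->
  exists alpha, acts_by (map_mx iota x) alpha.
Proof.
move=> Rx xC; have [a xE] := envelop_mxP Rx.
exists (fun i => (\sum_(g in G) f i (a g) * cv i g) / cv i 1%g).
split; first exact: map_group_ring.
move=> n rG irrG i t lt.
have opE : gring_op rG (map_mx iota x) = \sum_(g in G) iota (a g) *: rG g.
  rewrite xE map_mx_group_sum linear_sum; apply: eq_bigr => g Gg.
  by rewrite [LHS]linearZ /= gring_opG.
have [b bE] : exists b, gring_op rG (map_mx iota x) = b%:M.
  apply: (irr_cent_scalar irrG); apply/centgmxP => g Gg.
  have := congr1 (fun y => gring_op rG (map_mx iota y)) (xC g Gg).
  rewrite /= !map_mxM !map_mx_regular_repr !gring_opM ?envelop_mx_id ?map_group_ring //.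
  by rewrite gring_opG.
rewrite bE; congr (_%:M).
have nzn : n%:R != 0 :> K by rewrite ((pcharf0P K).1 char0K) -lt0n (irr_degree_gt0 irrG).
have [t' tE] := Gal_rmorph (f := in_adjoin iota (S i)) lt.1.
have tn : emb i (t (cv i 1%g)) = n%:R.
  by rewrite lt.2 // repr_mx1 mxtrace1.
apply: (mulIf nzn); rewrite -{2}tn -rmorphM -!tE -rmorphM mulfVK; last exact: char_val1_neq0.
rewrite [LHS]mulr_natr -mxtrace_scalar -bE opE raddf_sum !rmorph_sum.
apply: eq_bigr => g Gg; rewrite [LHS]mxtraceZ !rmorphM !tE lt.2 //; congr (_ * _).
by case: lt => -[_ _ _ ->].
Qed.

(** Translates the equation in [centre_sum] into [acts_by]. *)
Lemma map_group_ring_acts_by (x : 'M[F]_#|G|) alpha : (x \in group_ring F G)%MS ->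
  map_mx iota x = \sum_(i < k) centre_embed (alpha i) <-> acts_by (map_mx iota x) alpha.
Proof.
move=> Rx; split=> [->|ax]; first exact: acts_by_centre_embed.
exact: acts_by_inj ax (acts_by_centre_embed alpha).
Qed.

(** The commutator vanishes in every irreducible representation, where x is a scalar. *)
Lemma acts_by_comm (x y : 'M[F]_#|G|) alpha : acts_by (map_mx iota x) alpha ->
  (y \in group_ring F G)%MS -> (x \in group_ring F G)%MS -> x *m y = y *m x.
Proof.
move=> [RX ax] Ry Rx; apply: (map_mx_inj (f := iota)); apply/eqP; rewrite -subr_eq0; apply/eqP.
rewrite !map_mxM; have RY := map_group_ring Ry.
apply: (group_ring_eq0 char0K) => [|n rG irrG].
  by rewrite linearB /= addmx_sub ?eqmx_opp // envelop_mxM.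
have [i [t lt]] := label_exists irrG.
rewrite [LHS]linearB /= !gring_opM // (ax _ _ irrG _ _ lt).
by rewrite scalar_mxC subrr.
Qed.

End Representatives.

End CentreEmbed.

(** * Linear combinations with coefficients in a subring *)

Section SpanOver.
Variables (F : fieldType) (V : lmodType F) (o : {pred F}) (Ho : subring_closed o).
Variable X : set V.
Local Notation span := (span_over [set` o] X).

Lemma span_ind (P : V -> Prop) : P 0 -> (forall x y, P x -> P y -> P (x + y)) ->
  (forall c x, c \in o -> X x -> P (c *: x)) -> forall x, span x -> P x.
Proof.
move=> P0 PD PX x [n [c [y [oc Xy ->]]]]; apply: big_ind => // i _.
by apply: PX; [apply: oc | apply: Xy].
Qed.

Lemma span0 : span 0.
Proof.
exists 0%N, (fun=> 0), (fun=> 0); split; [by case|by case|by rewrite big_ord0].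
Qed.

Lemma spanD x y : span x -> span y -> span (x + y).
Proof.
move=> [n [c [u [oc Xu ->]]]] [m [d [w [od Xw ->]]]].
exists (n + m)%N, (fun i => match fintype.split i with inl j => c j | inr j => d j end),
  (fun i => match fintype.split i with inl j => u j | inr j => w j end); split.
- by move=> i; case: (fintype.split i) => j; [apply: oc | apply: od].
- by move=> i; case: (fintype.split i) => j; [apply: Xu | apply: Xw].
- rewrite big_split_ord /=; congr (_ + _); apply: eq_bigr => i _.
    by rewrite (unsplitK (inl i)).
  by rewrite (unsplitK (inr i)).
Qed.

Lemma spanZ a x : a \in o -> span x -> span (a *: x).
Proof.
move=> oa [n [c [u [oc Xu ->]]]]; exists n, (fun i => a * c i), u; split=> // [i|].
  exact: (rpredM (s := subring_pred Ho) oa (oc i)).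
by rewrite scaler_sumr; apply: eq_bigr => i _; rewrite scalerA.
Qed.

Lemma spanB x y : span x -> span y -> span (x - y).
Proof.
move=> sx sy; rewrite -scaleN1r; apply: spanD => //; apply: spanZ => //.
exact: (rpredN1 (subring_pred Ho)).
Qed.

Lemma span_incl x : X x -> span x.
Proof.
move=> Xx; exists 1%N, (fun=> 1), (fun=> x); split=> // [_|].
  exact: (rpred1 (subring_pred Ho)).
by rewrite big_ord1 scale1r.
Qed.

Lemma span_sum I (r : seq I) (P : pred I) (y : I -> V) :
  (forall i, P i -> span (y i)) -> span (\sum_(i <- r | P i) y i).
Proof. by move=> sy; apply: big_ind => //; [apply: span0 | apply: spanD]. Qed.

End SpanOver.

(** Repeated generators are collected into one coefficient per position of s; the coefficients are
    typed in o so that they can form matrices over o. *)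
Lemma span_seqP (F : fieldType) (V : lmodType F) (o : {pred F}) (Ho : subring_closed o)
    (s : seq V) x : span_over [set` o] [set` s] x ->
  exists c : 'I_(size s) -> subring_type Ho,
    x = \sum_(i < size s) subring_emb Ho (c i) *: s`_i.
Proof.
elim/span_ind => [|y z [c ->] [d ->]|a y oa sy].
- exists (fun=> 0); rewrite big1 // => i _; rewrite rmorph0; exact: scale0r.
- exists (fun i => c i + d i); rewrite -big_split; apply: eq_bigr => i _.
  by rewrite rmorphD scalerDl.
have [b <-] := subring_emb_onto Ho oa.
have lt : (index y s < size s)%N by rewrite index_mem.
exists (fun i => if i == Ordinal lt then b else 0).
rewrite (bigD1 (Ordinal lt)) //= eqxx nth_index // big1 ?addr0 // => i /negPf ->.
exact: scale0r.
Qed.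

(** * Integrality in orders, and adjunction of central integral elements *)

Section Orders.
Variables (F : fieldType) (o : {pred F}) (Ho : subring_closed o).
Variables (n : nat) (A L : set 'M[F]_n).

(* The multiplication matrix of x on generators of L has entries in o, and w is
   one of its eigenvalues. *)
Lemma order_int (K : fieldType) (iota : {rmorphism F -> K}) (phi : 'M[F]_n -> K) x y w :
  is_order o A L -> L x -> L y -> phi y != 0 ->
  (forall a b, phi (a + b) = phi a + phi b) ->
  (forall c a, phi (c *: a) = iota c * phi a) ->
  (forall a, L a -> phi (x *m a) = w * phi a) -> int_closure iota o w.
Proof.
move=> [_ _ _ LM [s Ls] _] Lx Ly nzy phiD phiZ phix.
have phi0 : phi 0 = 0 by rewrite -(scale0r 0) phiZ rmorph0 mul0r.
have phi_sum I (r : seq I) (a : I -> 'M[F]_n) :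
    phi (\sum_(i <- r) a i) = \sum_(i <- r) phi (a i).
  exact: (big_morph phi phiD phi0).
have Lnth (j : 'I_(size s)) : L s`_j.
  by rewrite Ls; apply: (span_incl Ho); apply: mem_nth.
have H (j : 'I_(size s)) : exists c : 'I_(size s) -> subring_type Ho,
    x *m s`_j = \sum_(i < size s) subring_emb Ho (c i) *: s`_i.
  by apply: span_seqP; rewrite -Ls; apply: LM.
have [m mE] := choice H.
pose g : {rmorphism subring_type Ho -> K} := iota \o subring_emb Ho.
pose M : 'M[subring_type Ho]_(size s) := \matrix_(k, j) m j k.
pose u : 'rV[K]_(size s) := \row_k phi s`_k.
have uM : u *m map_mx g M = w *: u.
  apply/rowP => j; rewrite !mxE -phix // mE phi_sum; apply: eq_bigr => k _.
  by rewrite !mxE phiZ mulrC.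
(* y is a combination of the generators and phi y is nonzero, so phi cannot vanish on all
   generators. *)
have nzu : u != 0.
  apply: contraNneq nzy => u0.
  have [c ->] : exists c : 'I_(size s) -> subring_type Ho,
    y = \sum_(i < size s) subring_emb Ho (c i) *: s`_i.
    by apply: span_seqP; rewrite -Ls.
  rewrite phi_sum big1 // => i _; rewrite phiZ.
  have := congr1 (fun u : 'rV_(size s) => u 0 i) u0; rewrite !mxE => ->.
  by rewrite mulr0.
have : root (char_poly (map_mx g M)) w.
  by rewrite -eigenvalue_root_char; apply/eigenvalueP; exists u.
rewrite -map_char_poly => h; apply/(int_closureP Ho).
by exists (char_poly M) => //; apply: char_poly_monic.
Qed.

(** As x is central and integral, L[x] is an order, generated by the a x^l with a a generator of L
    and l < d. Maximality gives L[x] = L. *)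
Lemma maximal_order_mem (p : {poly F}) x : is_maximal_order o A L ->
  (forall y z, A y -> A z -> A (y *m z)) ->
  A x -> (forall y, A y -> x *m y = y *m x) ->
  p \is monic -> p \is a polyOver o -> (1 < size p)%N ->
  \sum_(l < size p) p`_l *: x ^+ l = 0 -> L x.
Proof.
move=> [ordL maxL] AM Ax xC mp /(polyOver_subringP Ho) op sp px.
have [LA L1 LB LM [s Ls] LF] := ordL.
(* With F itself as the coefficient ring, the lemmas on spans also apply to A, the F-span of L. *)
have HoT : @subring_closed F predT by split.
have setTE : [set: F] = [set` predT] by apply/seteqP; split.
pose d := (size p).-1.
have spE : size p = d.+1 by rewrite prednK // (ltn_trans _ sp).
have d0 : (0 < d)%N by rewrite /d; case: (size p) sp => [|[|]].
pose gens := [seq a *m x ^+ l | a <- s, l <- iota 0 d].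
pose M := span_over [set` o] [set` gens].
have A0 : A 0 by rewrite LF setTE; apply: span0.
have AD y z : A y -> A z -> A (y + z) by rewrite LF setTE; apply: spanD.
have AZ c y : A y -> A (c *: y) by rewrite LF setTE; apply: (spanZ HoT).
have Axl l : A (x ^+ l).
  elim: l => [|l IH]; first by apply: LA; exact: L1.
  by rewrite exprS; apply: AM.
have xlC l y : A y -> x ^+ l *m y = y *m x ^+ l.
  move=> Ay; elim: l => [|l IH]; first by rewrite expr0 [LHS]mul1mx [RHS]mulmx1.
  rewrite exprS; change (x *m x ^+ l *m y = y *m (x *m x ^+ l)).
  by rewrite -mulmxA IH !mulmxA xC.
have xd : x ^+ d = - \sum_(l < d) p`_l *: x ^+ l.
  move: px; rewrite spE big_ord_recr /=.
  have -> : p`_d = 1 by have := monicP mp; rewrite lead_coefE.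
  by rewrite scale1r addrC => /eqP; rewrite addr_eq0 => /eqP.
(* Powers of x from the d-th on are lowered by the relation for x^d. *)
have Lin y : L y -> forall m, M (y *m x ^+ m).
  move=> Ly m; have [N] := ubnP m; elim: N m => // N IH m; rewrite ltnS => mN.
  have [md|dm] := ltnP m d.
    move: Ly; rewrite Ls; elim/span_ind => [|a b Ma Mb|c a oc sa].
    - by rewrite mul0mx; apply: span0.
    - by rewrite mulmxDl; apply: spanD.
    - rewrite -scalemxAl; apply: (spanZ Ho) => //; apply: (span_incl Ho).
      by apply: allpairs_f => //; rewrite mem_iota.
  have -> : y *m x ^+ m = \sum_(l < d) (- p`_l) *: (y *m x ^+ (m - d + l)).
    rewrite -{1}(subnK dm) exprD xd mulrN mulr_sumr.
    rewrite mulmxN mulmx_sumr -sumrN; apply: eq_bigr => l _.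
    rewrite scaleNr scalemxAr; congr (- (_ *m _)).
    rewrite exprD; exact: esym (scalemxAr _ _ _).
  apply: span_sum => l _; apply: (spanZ Ho).
    by rewrite (rpredN (subring_pred Ho)); apply: op.
  apply: IH; apply: leq_trans mN; rewrite -ltn_subRL subKn //.
have M_A y : M y -> A y.
  elim/span_ind => // c z oc /allpairsP[[a l] /= [sa _ ->]]; apply: AZ.
  by apply: AM => //; apply: LA; rewrite Ls; apply: (span_incl Ho).
have LsubM : L `<=` M.
  by move=> y Ly; have := Lin y Ly 0%N; rewrite expr0 [_ *m _]mulmx1.
have ordM : is_order o A M.
  split=> //.
  - exact: LsubM.
  - by move=> y z; apply: (spanB Ho).
  - move=> y z My Mz; elim/span_ind: y / My => [|a b Ma Mb|c a oc].
    + by rewrite mul0mx; apply: span0.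
    + by rewrite mulmxDl; apply: spanD.
    move=> /allpairsP[[y l] /= [sy _ ->]]; rewrite -scalemxAl; apply: (spanZ Ho) => //.
    elim/span_ind: z / Mz => [|a' b Ma Mb|c' a' oc'].
    + by rewrite mulmx0; apply: span0.
    + by rewrite mulmxDr; apply: spanD.
    move=> /allpairsP[[z l'] /= [sz _ ->]]; rewrite -scalemxAr; apply: (spanZ Ho) => //.
    have Ly : L y by rewrite Ls; apply: (span_incl Ho).
    have Lz : L z by rewrite Ls; apply: (span_incl Ho).
    have -> : y *m x ^+ l *m (z *m x ^+ l') = (y *m z) *m x ^+ (l + l').
      rewrite mulmxA -(mulmxA y) xlC; last exact: LA.
      by rewrite exprD !mulmxA.
    by apply: Lin; apply: LM.
  - by exists gens.
  - apply/seteqP; split=> y.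
      rewrite {1}LF setTE; elim/span_ind => [|a b Ma Mb|c a _ La].
      + exact: span0.
      + exact: spanD.
      + by apply: (spanZ HoT) => //; apply: (span_incl HoT); apply: LsubM.
    by rewrite setTE; elim/span_ind => // c a _ Ma; apply: AZ; apply: M_A.
rewrite -(maxL M ordM LsubM).
by have := Lin 1%:M L1 1%N; rewrite expr1 mul1mx.
Qed.

End Orders.

(** * The centre of the maximal order as the central elements with integral components *)

Section CentreOfMaximalOrder.
Variables (F : fieldType) (K : closedFieldType) (iota : {rmorphism F -> K}).
Hypotheses (Halg : is_alg_closure iota) (char0 : [pchar F] =i pred0).
Variables (gT : finGroupType) (G : {group gT}).
Variables (k : nat) (chi : 'I_k -> gT -> K).
Hypothesis Hchi : irr_representatives iota G chi.
Variables (o : {pred F}) (Ho : subring_closed o).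

Local Notation S i := [set chi i g | g in [set` G]].
Local Notation E i := (adjoin iota (S i)).
Local Notation emb i := (adjoin_emb iota (S i)).
Local Notation f i := (@in_adjoin F K iota (S i)).
Local Notation cv i := (char_val iota G (chi i) : gT -> E i).
Local Notation acts := (acts_by (iota := iota) (G := G) (chi := chi)).

Lemma acts_by_ext (A : 'M[K]_#|G|) (alpha beta : forall i, E i) :
  (forall i, alpha i = beta i) -> acts A alpha -> acts A beta.
Proof.
by move=> e [RA aA]; split=> // n rG irrG i t lt; rewrite -e; apply: aA.
Qed.

Lemma acts_byX (x : 'M[F]_#|G|) alpha l : acts (map_mx iota x) alpha ->
  acts (map_mx iota (x ^+ l)) (fun i => alpha i ^+ l).
Proof.
move=> ax; elim: l => [|l IH].
  rewrite expr0 (_ : map_mx iota 1 = 1%:M); last exact: map_mx1.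
  exact: acts_by1.
rewrite exprS (_ : map_mx iota (x * x ^+ l) = map_mx iota x *m map_mx iota (x ^+ l)).
  by apply: acts_by_ext (acts_byM ax IH) => i; rewrite exprS.
exact: map_mxM.
Qed.

Lemma regular_coef_inj (a b : gT -> F) :
  \sum_(g in G) a g *: regular_repr F G g = \sum_(g in G) b g *: regular_repr F G g ->
  {in G, a =1 b}.
Proof.
have proj (c : gT -> F) h : h \in G ->
    @gring_proj F gT G h (\sum_(g in G) c g *: regular_repr F G g) = c h *: 1.
  move=> Gh; rewrite linear_sum (bigD1 h) //= big1 ?addr0 => [|g /andP[Gg gh]].
    by rewrite [LHS]linearZ /= gring_projE // eqxx.
  by rewrite [LHS]linearZ /= gring_projE // eq_sym (negPf gh) scaler0.
move=> e h Gh; have := congr1 (@gring_proj F gT G h) e; rewrite !proj //.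
by move/matrixP => /(_ 0 0); rewrite !mxE !mulr1.
Qed.

(** The coefficient formula: the one at g is the sum over i of Tr (alpha_i chi_i(1) / |G|
    chi_i(g^-1)). It is forced, since alpha determines the element and the group elements are
    linearly independent. *)
Lemma acts_by_coef (alpha : forall i, E i) : exists a : 'I_k -> gT -> F,
  [/\ forall i g, Tr (f i) (alpha i * (cv i 1%g / #|G|%:R) * cv i g^-1%g) = f i (a i g),
      acts (map_mx iota (\sum_(g in G) (\sum_i a i g) *: regular_repr F G g)) alpha &
      forall b : gT -> F,
        acts (map_mx iota (\sum_(g in G) b g *: regular_repr F G g)) alpha ->
        {in G, forall g, b g = \sum_i a i g}].
Proof.
have irr_chi i : irr_char G (chi i) by case: Hchi.
have [a aP] := choice (fun i => centre_embed_coef Halg char0 (irr_chi i) (alpha i)).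
have aA : acts (map_mx iota (\sum_(g in G) (\sum_i a i g) *: regular_repr F G g)) alpha.
  have := acts_by_centre_embed Halg char0 Hchi alpha; congr (acts _ _).
  under eq_bigr => i _ do rewrite (aP i).2 map_mx_group_sum.
  rewrite exchange_big map_mx_group_sum; apply: eq_bigr => g Gg.
  by rewrite rmorph_sum scaler_suml.
exists a; split=> // [i g|b bA]; first exact: (aP i).1.
apply: regular_coef_inj; apply: (map_mx_inj (f := iota)).
exact: acts_by_inj bA aA.
Qed.

Lemma grp_ring_repr g : g \in G -> grp_ring_over G o (regular_repr F G g).
Proof.
move=> Gg; exists (fun h => (h == g)%:R).
  by move=> h _; case: eqP => _; [exact: (rpred1 (subring_pred Ho))|exact: (rpred0 (subring_pred Ho))].
rewrite (bigD1 g) //= eqxx scale1r big1 ?addr0 // => h /andP[_ /negPf ->].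
by rewrite scale0r.
Qed.

Variable Lambda' : set 'M[F]_#|G|.
Hypothesis Hmax : is_maximal_order o (grp_alg F G) Lambda'.
Hypothesis Hsub : grp_ring_over G o `<=` Lambda'.

Lemma centre_order_group_ring x : centre Lambda' x -> (x \in group_ring F G)%MS.
Proof. by case=> Lx _; case: Hmax => -[LA _ _ _ _ _] _; apply: LA. Qed.

(** Multiplication by x on the finitely generated module [Lambda'] has the component alpha_i as an
    eigenvalue. *)
Lemma centre_order_int x : centre Lambda' x ->
  exists2 alpha, acts (map_mx iota x) alpha & forall i, int_closure (f i) o (alpha i).
Proof.
move=> Cx; have Rx := centre_order_group_ring Cx; case: (Cx) => Lx xC.
have [|alpha ax] := centre_acts_by char0 Hchi Rx.
  by move=> g Gg; apply: xC; apply: Hsub; apply: grp_ring_repr.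
exists alpha => // i; have [n [rG [irrG l]]] := label_id Hchi i.
have n0 := irr_degree_gt0 irrG; pose z := Ordinal n0.
(* A diagonal entry of the representation affording chi_i: x acts there by the scalar alpha_i, and
   phi is 1 at the identity. *)
pose phi (y : 'M[F]_#|G|) := gring_op rG (map_mx iota y) z z.
have [ordL _] := Hmax; have [LA L1 _ _ _ _] := ordL.
apply/(int_closure_emb o _ (t := emb i) (g := iota)) => //.
apply: (order_int Ho (phi := phi) (y := 1%:M) ordL Lx) => //.
- by rewrite /phi map_mx1 gring_op1 mxE eqxx mulr1n oner_neq0.
- by move=> a b; rewrite /phi map_mxD linearD mxE.
- by move=> c a; rewrite /phi map_mxZ [gring_op _ _]linearZ mxE.
- move=> a /LA Ra; rewrite /phi map_mxM gring_opM; last exact: map_group_ring.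
  by case: ax => _ /(_ _ _ irrG _ _ l) ->; rewrite mul_scalar_mx mxE.
Qed.

(** A product of monic polynomials over o that vanish at the components vanishes at x, as is checked
    on components; so x can be adjoined to [Lambda']. *)
Lemma int_centre_order x alpha : (x \in group_ring F G)%MS ->
  acts (map_mx iota x) alpha -> (forall i, int_closure (f i) o (alpha i)) ->
  centre Lambda' x.
Proof.
move=> Rx ax ia; have [[LA _ _ _ _ _] _] := Hmax.
have xC y : (y \in group_ring F G)%MS -> x *m y = y *m x.
  by move=> Ry; apply: (acts_by_comm char0 Hchi ax).
split; last by move=> y /LA Ry; apply: xC.
have [p pP] := choice ia.
(* The factor X makes the degree positive whatever k is. *)
pose q := (\prod_i p i) * 'X.
have mP : \prod_i p i \is monic by apply: monic_prod => i _; case: (pP i).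
have mq : q \is monic by rewrite monicMl ?monicX.
apply: (maximal_order_mem Ho (p := q) Hmax _ Rx xC mq).
- by move=> y z Ry Rz; apply: envelop_mxM.
- have : q \is a polyOver (subring_pred Ho); last by [].
  by rewrite rpredM ?polyOverX // rpred_prod // => i _; case: (pP i).
- by rewrite size_mulX ?monic_neq0 // ltnS size_poly_gt0 monic_neq0.
apply: (map_mx_inj (f := iota)); rewrite map_mx0.
have a0 : acts 0 (fun i => 0).
  have := acts_byZ 0 (acts_by1 iota G chi); rewrite rmorph0 scale0r.
  by apply: acts_by_ext => i; rewrite [f i 0](rmorph0 (in_adjoin iota (S i))) mul0r.
apply: (acts_by_inj char0 Hchi _ a0).
have -> : map_mx iota (\sum_(l < size q) q`_l *: x ^+ l) =
    \sum_(l < size q) iota q`_l *: map_mx iota (x ^+ l).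
  rewrite (big_morph _ (@map_mxD _ _ iota _ _) (map_mx0 iota _ _)).
  by apply: eq_bigr => l _; rewrite map_mxZ.
have aS : acts (\sum_(l < size q) iota q`_l *: map_mx iota (x ^+ l))
    (fun i => \sum_(l < size q) f i q`_l * alpha i ^+ l).
  have aSl (l : 'I_(size q)) : acts (iota q`_l *: map_mx iota (x ^+ l))
      (fun i => f i q`_l * alpha i ^+ l) by apply: acts_byZ; apply: acts_byX.
  exact: acts_by_sum (index_enum _) _ _ aSl.
apply: acts_by_ext aS => i.
have : root (map_poly (in_adjoin iota (S i)) q) (alpha i).
  rewrite rmorphM rmorph_prod rootM (bigD1 i) //= rootM.
  by case: (pP i) => _ _ ->.
rewrite rootE horner_coef size_map_poly => /eqP h; rewrite -[RHS]h.
by apply: eq_bigr => l _; rewrite coef_map.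
Qed.

End CentreOfMaximalOrder.

(** * The two inclusions of the conductor formula *)

Theorem proposition6p19
  (F : fieldType) (v : F -> int) (HF : local_field v)
  (char0 : [pchar F] =i pred0)
  (p : nat) (Hp : residue_pchar v p)
  (gT : finGroupType) (G : {group gT})
  (Lambda' : set 'M[F]_#|G|)
  (Hmax : is_maximal_order (val_ring v) (grp_alg F G) Lambda')
  (Hsub : grp_ring_over G (val_ring v) `<=` Lambda')
  (Fbar : closedFieldType) (iota : {rmorphism F -> Fbar})
  (Hbar : is_alg_closure iota)
  (k : nat) (chi : 'I_k -> gT -> Fbar)
  (Hchi : irr_representatives iota G chi) :
  conductor (centre Lambda') (centre (grp_ring_over G (val_ring v))) =
  centre_sum (fun i => conductor_summand iota G (val_ring v) (chi i)).
Proof.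
have Ho := val_ring_subring HF; have Hval := val_ring_inv HF.
have irr_chi i : irr_char G (chi i) by case: Hchi.
pose stable i := fun s => @irr_char_Gal_stable F Fbar iota (pchar_closure iota char0) gT G (chi i) s (irr_chi i).
apply/seteqP; split=> x.
  move=> [Cx Hx]; have Rx := centre_order_group_ring Hmax Cx.
  have [alpha ax ia] := centre_order_int char0 Hchi Ho Hmax Hsub Cx.
  split=> //; exists alpha; last exact/(map_group_ring_acts_by Hbar char0 Hchi).
  move=> i; apply/(conductor_summandP Hbar char0 (irr_chi i) Ho Hval) => g Gg beta Obeta.
  (* The test element has the integral component beta at i and 0 elsewhere; it lies in the centre of
     [Lambda']. *)
  pose beta' := dfwith (fun j => 0 : char_field iota G (chi j)) beta.
  have [c [_ cA _]] := acts_by_coef Hbar char0 Hchi beta'.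
  set y := \sum_(g in G) _ in cA.
  have Cy : centre Lambda' y.
    apply: (int_centre_order char0 Hchi Ho Hmax _ cA).
      by apply/envelop_mxP; eexists.
    move=> j; rewrite /beta'; have [ij|ij] := eqVneq i j.
      by subst j; rewrite dfwith_in.
    by rewrite dfwith_out //; apply: (int_closure0 Ho).
  have [[b ob xyE] _] := Hx y Cy.
  have [a [aE _ aU]] := acts_by_coef Hbar char0 Hchi (fun j => alpha j * beta' j).
  have := aU b; rewrite -xyE [x * y]/(x *m y) map_mxM => /(_ (acts_byM ax cA)) bE.
  (* The coefficient of x y at g^-1 involves chi_j(g), and only the term j = i survives: it is the
     trace to be shown in o. *)
  exists (b g^-1%g); first by apply: ob; rewrite groupV.
  rewrite bE ?groupV // (bigD1 i) //= big1 ?addr0 => [|j ji].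
    by rewrite -aE /beta' dfwith_in invgK; congr (Tr _ _); ring.
  apply: (fmorph_inj (in_adjoin iota [set chi j g | g in [set` G]])).
  rewrite -[LHS]aE [RHS]rmorph0 /beta' dfwith_out 1?eq_sym // mulr0 !mul0r.
  have := Tr_char_fieldD Hbar (stable j) 0 0; rewrite addr0 => /eqP.
  by rewrite -{1}[Tr _ _]addr0 (inj_eq (addrI _)) => /eqP <-.
move=> [Rx [alpha Ialpha xE]].
have ax : acts_by (map_mx iota x) alpha by apply/(map_group_ring_acts_by Hbar char0 Hchi).
(* Each term in the coefficient of x y at g is the trace of an element of the inverse different
   times the integral component of y, hence lies in o. *)
have key y : centre Lambda' y -> centre (grp_ring_over G (val_ring v)) (x * y).
  move=> Cy; have Ry := centre_order_group_ring Hmax Cy.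
  have [beta ay ib] := centre_order_int char0 Hchi Ho Hmax Hsub Cy.
  have Rxy : (x *m y \in group_ring F G)%MS by apply: envelop_mxM.
  have axy : acts_by (map_mx iota (x *m y)) (fun j => alpha j * beta j).
    by rewrite map_mxM; apply: acts_byM.
  split; last first.
    move=> z [c oc zE]; apply: (acts_by_comm char0 Hchi axy) => //.
    by rewrite zE; apply/envelop_mxP; exists c.
  have [b xyE] := envelop_mxP Rxy; exists b => // g Gg.
  have [a [aE _ aU]] := acts_by_coef Hbar char0 Hchi (fun j => alpha j * beta j).
  rewrite xyE in axy; rewrite (aU b axy g Gg).
  apply: (@rpred_sum _ (subring_pred Ho)) => i _.
  have /(conductor_summandP Hbar char0 (irr_chi i) Ho Hval)/(_ g^-1%g) := Ialpha i.
  rewrite groupV => /(_ Gg _ (ib i))[d od dE].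
  suff -> : a i g = d by [].
  apply: (fmorph_inj (in_adjoin iota [set chi i g | g in [set` G]])).
  rewrite -[LHS]aE -[RHS]dE; congr (Tr _ _).
  by ring.
(* Taking y = 1 shows that x itself lies in o[G], hence in [Lambda']. *)
have C1 : centre Lambda' 1%:M.
  case: Hmax => -[_ L1 _ _ _ _] _; split=> // y _.
  by rewrite [LHS]mul1mx [RHS]mulmx1.
split=> //; case: (Hmax) => -[LA _ _ _ _ _] _.
have [h _] := key _ C1; move: h; rewrite [x * _]mulmx1 => /Hsub Lx; split=> // y /LA Ry.
exact: (acts_by_comm char0 Hchi ax).
Qed.
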